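(* Assume that $k=(k_1,k_2)\in C^1(\mathbb{R}^+\times\mathbb{R}^3;\mathbb{R}^2)$, with $k(t,0)=0$ for all $t\ge0$, is a time-periodic (in $t$) uniform stabilizer for the system $$\dot x_1=u_1,\quad\dot x_2=x_1u_2,\quad\dot x_3=u_2,$$ i.e., the feedback law $u_1(t)=k_1(t,x_1(t),x_2(t),x_3(t))$, $u_2(t)=k_2(t,x_1(t),x_2(t),x_3(t))$ uniformly globally stabilizes $0\in\mathbb{R}^3$ for this system. Then for every $r,\tau\ge0$, $T>0$ the sampled-data dynamic feedback, with $\tau_i=t_0+iT$, $i\in Z^+$, $$\dot z_x(t)=v(t)\cos(z_\theta(t)),\quad\dot z_y(t)=v(t)\sin(z_\theta(t)),\quad\dot z_\theta(t)=\omega(t),\qquad t\in[\tau_i,\tau_{i+1}),$$ $$z_x(\tau_{i+1})=x(\tau_{i+1}-r)+\int_{\tau_{i+1}-r-\tau}^{\tau_{i+1}}v(s)\cos\Big(\theta(\tau_{i+1}-r)+\int_{\tau_{i+1}-r-\tau}^{s}\omega(p)\,dp\Big)ds,$$ $$z_y(\tau_{i+1})=y(\tau_{i+1}-r)+\int_{\tau_{i+1}-r-\tau}^{\tau_{i+1}}v(s)\sin\Big(\theta(\tau_{i+1}-r)+\int_{\tau_{i+1}-r-\tau}^{s}\omega(p)\,dp\Big)ds,$$ $$z_\theta(\tau_{i+1})=\theta(\tau_{i+1}-r)+\int_{\tau_{i+1}-r-\tau}^{\tau_{i+1}}\omega(s)\,ds,$$ and, for $t>t_0$, $$v(t)=k_1\big(t+\tau,\,\zeta(t)\big)+\big(z_x(t)\sin(z_\theta(t))-z_y(t)\cos(z_\theta(t))\big)\omega(t),\qquad\omega(t)=k_2\big(t+\tau,\,\zeta(t)\big),$$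 where $$\zeta(t)=\big(z_x(t)\cos(z_\theta(t))+z_y(t)\sin(z_\theta(t)),\ z_x(t)\sin(z_\theta(t))-z_y(t)\cos(z_\theta(t)),\ z_\theta(t)\big),$$ achieves uniform global stabilization of $0\in\mathbb{R}^3$ for the system $$\dot x(t)=v(t-\tau)\cos(\theta(t)),\quad\dot y(t)=v(t-\tau)\sin(\theta(t)),\quad\dot\theta(t)=\omega(t-\tau).$$
   Context: Notation. $\mathbb{R}^+=[0,\infty)$, $Z^+$ is the set of non-negative integers, $|\cdot|$ is the Euclidean norm, $KL$ is the standard class of comparison functions. $L^\infty(I;U)$ is the space of measurable and bounded functions on $I$ with values in $U$; functions differing on a null set are not identified. $(T_a(t)\phi)(s)=\phi(t+s)$ for $s\in[-a,0]$, and $\|\phi\|_a=\sup_{s\in[-a,0]}|\phi(s)|$ (actual supremum). Convention: for $a=0$, $C^0([-a,0];\mathbb{R}^n)=L^\infty([-a,0];\mathbb{R}^n)=\mathbb{R}^n$. Here $(x,y,\theta)\in\mathbb{R}^3$ is the state of a vehicle (nonholonomic mobile robot), $v,\omega\in\mathbb{R}$ are the inputs, $\tau$ is the input delay, $r$ is the measurement delay, $T$ is the sampling period and $t_0\ge0$ is the initial time. Uniform global stabilization of $0\in\mathbb{R}^3$ for the delay-free system by $u=k(t,x)$ means: there exists $\sigma\in KL$ such that for every $(t_0,x_0)\in\mathbb{R}^+\times\mathbb{R}^3$ the closed-loop solution with $x(t_0)=x_0$ satisfies $|x(t)|\le\sigma(|x_0|,t-t_0)$ for all $t\ge t_0$.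 Uniform global stabilization for the delayed system by the sampled-data dynamic feedback means: writing $X=(x,y,\theta)$, $z=(z_x,z_y,z_\theta)$, $U=(v,\omega)$, there exists $\tilde\sigma\in KL$ such that for every $t_0\ge0$ and every $(X_0,z_0,U_0)\in C^0([-r,0];\mathbb{R}^3)\times\mathbb{R}^3\times L^\infty([-r-\tau,0];\mathbb{R}^2)$ the closed-loop solution with $T_r(t_0)X=X_0$, $z(t_0)=z_0$, $T_{r+\tau}(t_0)U=U_0$ satisfies $|z(t)|+\|T_r(t)X\|_r+\|T_{r+\tau}(t)U\|_{r+\tau}\le\tilde\sigma(|z_0|+\|X_0\|_r+\|U_0\|_{r+\tau},t-t_0)$ for all $t\ge t_0$. *)

(* Defs.v *)
From HB Require Import structures.
From mathcomp Require Import all_boot all_order all_algebra.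
From mathcomp Require Import all_classical all_reals all_analysis.

Set Implicit Arguments.
Unset Strict Implicit.
Unset Printing Implicit Defensive.

Import Order.TTheory GRing.Theory Num.Theory.
Import numFieldNormedType.Exports.

Local Open Scope classical_set_scope.
Local Open Scope ring_scope.

(* Vectors of R^n are row vectors; the i-th coordinate of [x], counted from
   zero, is [x 0 i].  Signals (functions of time) are total functions on [R],
   but every definition below only looks at them on the relevant interval. *)

(* The norm that the library puts on ['rV[R]_n] is the max norm. *)
Definition enorm (R : realType) (n : nat) (x : 'rV[R]_n) : R :=
  Num.sqrt (\sum_(i < n) x ord0 i ^+ 2).

Definition vec3 (R : realType) (a b c : R) : 'rV[R]_3 :=
  \row_(i < 3) nth 0 [:: a; b; c] i.

Definition class_KL (R : realType) (sigma : R -> R -> R) : Prop :=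
  [/\ {within [set p : R * R | 0 <= p.1 /\ 0 <= p.2],
        continuous (fun p => sigma p.1 p.2)},
      forall t, 0 <= t -> sigma 0 t = 0,
      forall t s1 s2, 0 <= t -> 0 <= s1 -> s1 < s2 -> sigma s1 t < sigma s2 t,
      forall s t1 t2, 0 <= s -> 0 <= t1 -> t1 <= t2 -> sigma s t2 <= sigma s t1
    & forall s, 0 <= s -> sigma s t @[t --> +oo] --> (0 : R)].

(* [f] is C^1 on R^+ x R^n; the differential [df p] at a point of the boundary
   {0} x R^n is taken relative to the domain, i.e. one-sided in time.  The
   spaces being finite dimensional, continuity of [df] is pointwise continuity. *)
Definition C1_halfspace (R : realType) (n m : nat)
    (f : R -> 'rV[R]_n -> 'rV[R]_m) : Prop :=
  let D : set (R * 'rV[R]_n) := [set p | 0 <= p.1] in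
  exists df : R * 'rV[R]_n -> {linear (R * 'rV[R]_n)%type -> 'rV[R]_m},
    (forall p, D p -> forall e : R, 0 < e ->
      \forall q \near within D (nbhs p),
        `|f q.1 q.2 - f p.1 p.2 - df p (q - p)| <= e * `|q - p|) /\
    (forall h, {within D, continuous (fun p => df p h)}).

Definition time_periodic (R : realType) (n m : nat)
    (f : R -> 'rV[R]_n -> 'rV[R]_m) : Prop :=
  exists2 P : R, 0 < P & forall t x, 0 <= t -> f (t + P) x = f t x.

(* The real line with the sigma-algebra of Lebesgue measurable sets, on which
   the completed Lebesgue measure lives. *)
Definition lebesgueT (R : realType) :=
  caratheodory_type (wlength (@idfun R))^*%mu.

Definition lebesgue_measurable_fun (R : realType) (D : set R) (f : R -> R) :=
  @measurable_fun _ _ (lebesgueT R) R D f.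

Definition lint (R : realType) (a b : R) (f : R -> R) : R :=
  \int[@completed_lebesgue_measure R]_(s in `[a, b]) f s.

(* The history (T_a(t) phi)(s) = phi (t + s), read for s in [-a, 0]; the window
   length a only appears in the function spaces and the norm. *)
Definition hist (R : realType) (V : Type) (t : R) (phi : R -> V) : R -> V :=
  fun s => phi (t + s).

Definition space_C0 (R : realType) (n : nat) (a : R) (phi : R -> 'rV[R]_n) :=
  {within `[- a, 0], continuous phi}.

Definition space_Linf (R : realType) (n : nat) (a : R) (phi : R -> 'rV[R]_n) :=
  (forall j, lebesgue_measurable_fun `[- a, 0] (fun s => phi s ord0 j)) /\
  exists M : R, forall s, s \in `[- a, 0] -> enorm (phi s) <= M.

Definition hnorm (R : realType) (n : nat) (a : R) (phi : R -> 'rV[R]_n) : R :=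
  sup [set enorm (phi s) | s in `[- a, 0]].

(* Right-hand side of x1' = u1, x2' = x1 u2, x3' = u2. *)
Definition chained_field (R : realType) (x : 'rV[R]_3) (u : 'rV[R]_2) :
    'rV[R]_3 :=
  vec3 (u 0 0) (x 0 0 * u 0 1) (u 0 1).

Definition vehicle_field (R : realType) (q : 'rV[R]_3) (u : 'rV[R]_2) :
    'rV[R]_3 :=
  vec3 (u 0 0 * cos (q 0 2)) (u 0 0 * sin (q 0 2)) (u 0 1).

Definition solves_at (R : realType) (n : nat) (y : R -> 'rV[R]_n) (t : R)
    (d : 'rV[R]_n) : Prop :=
  forall j, is_derive t (1 : R) (fun s => y s ord0 j : R) (d ord0 j).

Definition chained_closed_loop (R : realType) (k : R -> 'rV[R]_3 -> 'rV[R]_2)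
    (t0 : R) (x0 : 'rV[R]_3) (x : R -> 'rV[R]_3) : Prop :=
  [/\ x t0 = x0,
      {within `[t0, +oo[, continuous x}
    & forall t, t0 < t -> solves_at x t (chained_field (x t) (k t (x t)))].

(* "The solution satisfies ..." is read as: a solution exists on [t0, +oo[, and
   every solution satisfies the estimate. *)
Definition stabilizes_chained (R : realType)
    (k : R -> 'rV[R]_3 -> 'rV[R]_2) : Prop :=
  exists2 sigma : R -> R -> R, class_KL sigma &
    forall (t0 : R) (x0 : 'rV[R]_3), 0 <= t0 ->
      (exists x, chained_closed_loop k t0 x0 x) /\
      (forall x, chained_closed_loop k t0 x0 x ->
        forall t, t0 <= t -> enorm (x t) <= sigma (enorm x0) (t - t0)).

Definition zeta (R : realType) (z : 'rV[R]_3) : 'rV[R]_3 :=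
  vec3 (z 0 0 * cos (z 0 2) + z 0 1 * sin (z 0 2))
       (z 0 0 * sin (z 0 2) - z 0 1 * cos (z 0 2))
       (z 0 2).

(* Position at time b of a vehicle that is at [q] at time a and is driven by
   the input [U] over [a, b]. *)
Definition predictor (R : realType) (a b : R) (q : 'rV[R]_3)
    (U : R -> 'rV[R]_2) : 'rV[R]_3 :=
  let heading s := q 0 2 + lint a s (fun p => U p 0 1) in
  vec3 (q 0 0 + lint a b (fun s => U s 0 0 * cos (heading s)))
       (q 0 1 + lint a b (fun s => U s 0 0 * sin (heading s)))
       (q 0 2 + lint a b (fun s => U s 0 1)).

Definition sampling_time (R : realType) (t0 T : R) (i : nat) : R :=
  t0 + i%:R * T.

Record delayed_closed_loop (R : realType) (k : R -> 'rV[R]_3 -> 'rV[R]_2)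
    (r tau T t0 : R) (X0 : R -> 'rV[R]_3) (z0 : 'rV[R]_3) (U0 : R -> 'rV[R]_2)
    (X z : R -> 'rV[R]_3) (U : R -> 'rV[R]_2) : Prop := DelayedClosedLoop {
  dcl_X0 : forall s, s \in `[- r, 0] -> hist t0 X s = X0 s;
  dcl_z0 : z t0 = z0;
  dcl_U0 : forall s, s \in `[- (r + tau), 0] -> hist t0 U s = U0 s;
  dcl_X_cont : {within `[t0 - r, +oo[, continuous X};
  (* U is measurable and bounded on [t0 - r - tau, t] *)
  dcl_U_Linf : forall t, t0 <= t ->
    space_Linf (t - t0 + r + tau) (hist t U);
  (* the vehicle; since U0 is only measurable, its differential equation is
     understood in the sense of Caratheodory *)
  dcl_plant : forall t j, t0 <= t ->
    X t ord0 j =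
    X t0 ord0 j + lint t0 t (fun s => vehicle_field (X s) (U (s - tau)) ord0 j);
  (* the observer between sampling times; the equation is not imposed at the
     left end point because U t0 is an initial datum, not a feedback value *)
  dcl_z_cont : forall i,
    {within `[sampling_time t0 T i, sampling_time t0 T i.+1[, continuous z};
  dcl_z_flow : forall i t,
    sampling_time t0 T i < t -> t < sampling_time t0 T i.+1 ->
    solves_at z t (vehicle_field (z t) (U t));
  dcl_z_reset : forall i, let b := sampling_time t0 T i.+1 in
    z b = predictor (b - r - tau) b (X (b - r)) U;
  dcl_v : forall t, t0 < t ->
    U t 0 0 = k (t + tau) (zeta (z t)) 0 0 +
      (z t 0 0 * sin (z t 0 2) - z t 0 1 * cos (z t 0 2)) * U t 0 1;
  dcl_omega : forall t, t0 < t -> U t 0 1 = k (t + tau) (zeta (z t)) 0 1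
}.

Definition delayed_stabilizes (R : realType) (k : R -> 'rV[R]_3 -> 'rV[R]_2)
    (r tau T : R) : Prop :=
  exists2 sigma : R -> R -> R, class_KL sigma &
    forall (t0 : R) (X0 : R -> 'rV[R]_3) (z0 : 'rV[R]_3) (U0 : R -> 'rV[R]_2),
      0 <= t0 -> space_C0 r X0 -> space_Linf (r + tau) U0 ->
      (exists X z U, delayed_closed_loop k r tau T t0 X0 z0 U0 X z U) /\
      (forall X z U, delayed_closed_loop k r tau T t0 X0 z0 U0 X z U ->
        forall t, t0 <= t ->
          enorm (z t) + hnorm r (hist t X) + hnorm (r + tau) (hist t U) <=
          sigma (enorm z0 + hnorm r X0 + hnorm (r + tau) U0) (t - t0)).

(* Main.v *)
Require Import Defs.
From mathcomp Require Import all_boot all_order all_algebra.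
From mathcomp Require Import all_classical all_reals all_analysis.
From mathcomp Require Import measurable_realfun ring lra.
Set Implicit Arguments.
Unset Strict Implicit.
Unset Printing Implicit Defensive.
Import Order.TTheory GRing.Theory Num.Theory.
Import numFieldNormedType.Exports.
Local Open Scope classical_set_scope.
Local Open Scope ring_scope.

(** Why the sampled feedback stabilizes.

    The map [zeta] is a norm-preserving involution of the state space that turns
    the vehicle into the chained system, provided that the forward speed contains
    the term compensating the lateral drift ([zeta_vehicle], [zeta_chained]).
    Between two sampling times the observer [z] is a vehicle driven by the current
    input, so [s |-> zeta (z (s - tau))] solves the closed loop of the chained
    system with the feedback [k] evaluated at its own time: shifting the time by
    [tau] cancels the [t + tau] in the control law.  Only global solutions are
    known to decay, but a piece of a solution is continued by a global one, the
    singularity at the junction being removable ([chained_local_bound]).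

    The vehicle seen [tau] ahead is driven by the current input too
    ([plant_shift]), and its equations are solved by successive integrations.
    Hence, as soon as the measurement at a sampling time is taken after the
    initial time, the predictor that resets the observer returns exactly the
    state of the vehicle [tau] ahead, and from then on [z t = X (t + tau)]
    ([predictor_exact], [observer_exact]).  The observer then has no jump any more,
    it is one global solution of the chained closed loop and decays
    ([observer_tail_bound]); the vehicle is its delayed copy and the input is
    bounded by a function of it.

    There remain the finitely many sampling periods before that time, whose
    number depends on [r], [tau] and [T] only.  On each of them the quantities at stake
    are bounded by gains of their previous bounds ([bounded_step]); here the
    periodicity of [k] gives a bound on the feedback that is uniform in time
    ([feedback_gain]).  The two regimes combine into one KL function
    ([KL_delay]).  Existence follows the same structure, one sampling period at a
    time ([delayed_solution]).

    Initial inputs are merely Lebesgue measurable and bounded, so integrals are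
    taken with respect to the completed Lebesgue measure, of which translation
    invariance, additivity in the interval and the fundamental theorem at
    continuity points are proved first. *)

(** * Lebesgue integration over a compact interval *)

Section LebesgueIntegral.
Variable R : realType.
Implicit Types (f g : R -> R) (a b c : R) (A : set R).

Notation olen := (@mu_ext _ (ocitv_type R) R (wlength (@idfun R))).
Notation cmu := (@completed_lebesgue_measure R).

Lemma lebesgueT_sub A :
  @measurable _ (measurableTypeR R) A -> @measurable _ (lebesgueT R) A.
Proof. by move=> mA; apply: sub_caratheodory. Qed.

Let outer_shift_le c A : (olen [set x | A (x + c)%R] <= olen A)%E.
Proof.
apply: le_ereal_inf_tmp => _ [F [mF AF] <-].
apply: ereal_inf_lbound; exists (fun k => [set x | F k (x + c)]).
  split=> [k|x /AF [k _ Fk]]; last by exists k.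
  have [p _ <-] := mF k; exists (p.1 - c, p.2 - c) => //=.
  by apply/seteqP; split => x /=; rewrite !in_itv /= ltrBlDr lerBrDr.
apply: eq_eseriesr => k _; have [p _ <-] := mF k.
have -> : [set x | [set` `]p.1, p.2]] (x + c)] = [set` `]p.1 - c, p.2 - c]].
  by apply/seteqP; split => x /=; rewrite !in_itv /= ltrBlDr lerBrDr.
rewrite !wlength_itv /= !lte_fin ltrD2r; case: ifP => // _.
by rewrite -!EFinB; congr EFin; rewrite opprB addrA subrK.
Qed.

(** Translating a cover by half-open intervals gives a cover of the translated
    set with the same total length. *)
Lemma outer_measure_shift c A : olen [set x | A (x + c)] = olen A.
Proof.
apply/eqP; rewrite eq_le outer_shift_le /=.
have := outer_shift_le (- c) [set x | A (x + c)].
by congr (_ <= _)%E; congr olen; apply/seteqP; split => x /=; rewrite subrK.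
Qed.

(** Caratheodory's criterion is stated with the outer measure of arbitrary test
    sets, hence it inherits the invariance of the outer measure. *)
Lemma lebesgueT_shift c A : @measurable _ (lebesgueT R) A ->
  @measurable _ (lebesgueT R) [set x | A (x + c)].
Proof.
suff cara : caratheodory_measurable olen A ->
    caratheodory_measurable olen [set x | A (x + c)%R] by exact: cara.
move=> mA X; rewrite -(outer_measure_shift (- c) X) mA.
rewrite -(outer_measure_shift c ([set x | X (x - c)] `&` A)).
rewrite -(outer_measure_shift c ([set x | X (x - c)] `&` ~` A)).
by congr (olen _ + olen _)%E; apply/seteqP; split => x /=; rewrite addrK.
Qed.

Lemma lebesgue_measurable_shift c : @measurable_fun _ _ (lebesgueT R)
  (lebesgueT R) setT (fun x : R => x + c).
Proof. by move=> _ Y mY; rewrite setTI; apply: lebesgueT_shift. Qed.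

Lemma lebesgueT_itv (i : interval R) : @measurable _ (lebesgueT R) [set` i].
Proof. by apply: lebesgueT_sub; apply: measurable_itv. Qed.
Hint Resolve lebesgueT_itv : core.

Lemma cmu_itv (i : interval R) : cmu [set` i] =
  (if (i.1 < i.2)%E then ((i.2 : \bar R) - i.1)%E else 0%E).
Proof. exact: lebesgue_measure_itv. Qed.

(** The class of integrands met below: inputs are only measurable and bounded,
    and it is stable under the products that occur in the vehicle equation. *)
Definition lbounded a b f := lebesgue_measurable_fun `[a, b] f /\
  exists M : R, forall s, a <= s <= b -> `|f s| <= M.

Lemma lbounded_integrable a b f :
  lbounded a b f -> cmu.-integrable `[a, b] (EFin \o f).
Proof.
move=> [mf [M fM]]; apply: measurable_bounded_integrable => //.
  change (cmu `[a, b] < +oo)%E.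
  by rewrite cmu_itv /= lte_fin; case: ifP => // _; rewrite -EFinB ltry.
exists M; split => [|x Mx]; first exact: num_real.
move=> s /=; rewrite in_itv /= => /fM /le_trans; apply.
exact: ltW.
Qed.

Lemma lbounded_sub a b a' b' f : a <= a' -> b' <= b ->
  lbounded a b f -> lbounded a' b' f.
Proof.
move=> aa bb [mf [M fM]]; split.
  apply: (measurable_funS _ _ mf) => //.
  by apply: subset_itv; rewrite bnd_simp.
by exists M => s /andP[h1 h2]; apply: fM; rewrite (le_trans aa h1) (le_trans h2).
Qed.

Lemma lbounded_eq a b f g : (forall s, a <= s <= b -> f s = g s) ->
  lbounded a b f -> lbounded a b g.
Proof.
move=> fg [mf [M fM]]; split.
  apply: eq_measurable_fun mf => s; rewrite inE /= in_itv /=.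
  by move/fg.
by exists M => s h; rewrite -fg // fM.
Qed.

Lemma lbounded_mul a b f g : lbounded a b f -> lbounded a b g ->
  lbounded a b (fun s => f s * g s).
Proof.
move=> [mf [M fM]] [mg [N gN]]; split; first exact: measurable_funM.
by exists (M * N) => s h; rewrite normrM ler_pM ?fM ?gN.
Qed.

Lemma continuous_lebesgue_measurable (i : interval R) f :
  {within [set` i], continuous f} -> lebesgue_measurable_fun [set` i] f.
Proof.
move=> cf _ Y mY; apply: lebesgueT_sub.
apply: (subspace_continuous_measurable_fun _ cf) => //.
Qed.

Lemma lbounded_continuous a b f :
  {within `[a, b], continuous f} -> lbounded a b f.
Proof.
move=> cf; split; first exact: continuous_lebesgue_measurable.
have [ab|ba] := leP a b; last first.
  exists 0 => s /andP[h1 h2]; have := le_lt_trans (le_trans h1 h2) ba.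
  by rewrite ltxx.
have [c1 _ h1] := EVT_max ab cf; have [c2 _ h2] := EVT_min ab cf.
exists (`|f c1| + `|f c2|) => s hs.
have {}h1 := h1 s hs; have {}h2 := h2 s hs.
have [l1 l2] : f c1 <= `|f c1| /\ - `|f c2| <= f c2.
  by split; [exact: ler_norm|rewrite lerNl -normrN ler_norm].
rewrite ler_norml; apply/andP; split.
  by rewrite opprD (le_trans _ h2) // (le_trans _ l2) // gerDr oppr_le0.
by rewrite (le_trans h1) // (le_trans l1) // lerDl.
Qed.

Lemma lbounded_cst a b m : lbounded a b (fun=> m).
Proof. by apply: lbounded_continuous => x; exact: cst_continuous. Qed.

Lemma lbounded_shift a b c f :
  lbounded a b f -> lbounded (a + c) (b + c) (fun s => f (s - c)).
Proof.
move=> [mf [M fM]]; split; last first.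
  by exists M => s h; rewrite fM // lerBrDr lerBlDr.
move=> _ Y mY.
have := lebesgueT_shift (- c) (mf (lebesgueT_itv _) Y mY).
congr measurable; apply/seteqP; split => x /=; rewrite !in_itv /= lerBrDr lerBlDr //.
Qed.

Lemma lbounded_cat a c b f g h : a <= c -> c <= b ->
  lbounded a c f -> lbounded c b g ->
  (forall s, a <= s < c -> f s = h s) -> (forall s, c < s <= b -> g s = h s) ->
  lbounded a b h.
Proof.
move=> ac cb [mf [M fM]] [mg [N gN]] fh gh; split; last first.
  exists (Num.max (Num.max M N) `|h c|) => s /andP[as_ sb]; rewrite !le_max.
  case: (ltgtP s c) => [sc|cs|->]; last by rewrite lexx orbT.
    by rewrite -fh ?as_ // fM // as_ ltW.
  by rewrite -gh ?cs // gN ?orbT // sb ltW.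
have -> : `[a, b]%classic = `[a, c[ `|` (`[c, c] `|` `]c, b]) :> set R.
  apply/seteqP; split => s /=; rewrite !in_itv /=.
    move=> /andP[-> ->]; case: (ltgtP s c) => ?; [by left|right; right|right; left] => //.
  by case=> [/andP[-> /ltW/le_trans->]|[/andP[/(le_trans ac)-> /le_trans->]|/andP[/ltW/(le_trans ac)-> ->]]].
apply/measurable_funU => //; first by apply: measurableU.
have m1 : lebesgue_measurable_fun `[a, c[ f.
  by apply: measurable_funS mf => //; apply: subset_itv; rewrite bnd_simp.
have m2 : lebesgue_measurable_fun `[c, c] (fun=> h c) by exact: measurable_cst.
have m3 : lebesgue_measurable_fun `]c, b] g.
  by apply: measurable_funS mg => //; apply: subset_itv; rewrite bnd_simp.
split.
  by apply: eq_measurable_fun m1 => s; rewrite inE /= in_itv /= => /fh.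
apply/measurable_funU => //; split.
  apply: eq_measurable_fun m2 => s; rewrite inE /= in_itv /= => /andP[? ?].
  by congr h; apply: le_anti; apply/andP.
by apply: eq_measurable_fun m3 => s; rewrite inE /= in_itv /= => /gh.
Qed.

Lemma lint_eq a b f g : (forall s, a <= s <= b -> f s = g s) ->
  lint a b f = lint a b g.
Proof.
move=> fg; apply: eq_Rintegral => s; rewrite inE /= in_itv /=; exact: fg.
Qed.

Lemma lint_point a f : lint a a f = 0.
Proof.
rewrite /lint /Rintegral set_itv1 null_set_integral //.
- by rewrite -set_itv1.
- move=> _ Y mY; have [fY|fY] := pselect (Y (f a)%:E).
    rewrite (_ : _ `&` _ = `[a, a]%classic) //; rewrite set_itv1.
    by apply/seteqP; split => [x []|x ->].
  suff -> : [set a] `&` [set x | Y (f x)%:E] = set0.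
    by apply: lebesgueT_sub; exact: measurable0.
  by apply/seteqP; split => [x [->]|x] //.
- by rewrite -set_itv1; apply: etrans (cmu_itv _) _; rewrite /= ltxx.
Qed.

Lemma lint_oc a b f : lbounded a b f ->
  lint a b f = \int[cmu]_(s in `]a, b]) f s.
Proof.
move=> /lbounded_integrable fi.
have [ba|ab] := ltP b a.
  by rewrite /lint !set_itv_ge // bnd_simp -?ltNge -?leNgt // ltW.
rewrite /lint /Rintegral; congr fine.
rewrite (@negligible_integral _ _ _ cmu _ `[a, a] (EFin \o f)) //.
  congr (integral _ _ _).
  apply/seteqP; split => x /=; rewrite !in_itv /=.
    move=> [/andP[h1 h2]] /negP; rewrite -eq_le => h3.
    by rewrite h2 andbT lt_neqAle h1 andbT.
  move=> /andP[h1 h2]; rewrite (ltW h1) h2; split => //.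
  by rewrite leNgt h1.
by apply: etrans (cmu_itv _) _; rewrite /= ltxx.
Qed.

Lemma lint_oo a b f : lbounded a b f ->
  lint a b f = \int[cmu]_(s in `]a, b[) f s.
Proof.
move=> fi; rewrite lint_oc //.
have [ba|ab] := leP b a.
  by rewrite !set_itv_ge // bnd_simp -?ltNge -?leNgt // ltW.
rewrite /Rintegral; congr fine.
rewrite (@negligible_integral _ _ _ cmu _ `[b, b] (EFin \o f)) //.
- congr (integral _ _ _).
  apply/seteqP; split => x /=; rewrite !in_itv /=.
    move=> [/andP[h1 h2]] /negP; rewrite -eq_le => h3.
    by rewrite h1 lt_neqAle eq_sym h3.
  move=> /andP[h1 h2]; rewrite h1 (ltW h2); split => //.
  by rewrite leNgt h2.
- apply: integrableS (lbounded_integrable fi) => //.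
  exact: subset_itv_oc_cc.
by apply: etrans (cmu_itv _) _; rewrite /= ltxx.
Qed.

(** End points are null sets.  This matters because the input at a sampling
    time is computed from an integral that extends up to that very time. *)
Lemma lint_eq_oo a b f g : lbounded a b f -> lbounded a b g ->
  (forall s, a < s < b -> f s = g s) -> lint a b f = lint a b g.
Proof.
move=> bf bg fg; rewrite !lint_oo //; apply: eq_Rintegral => s.
by rewrite inE /= in_itv /=; exact: fg.
Qed.

Lemma lint_split a b c f : a <= b -> b <= c -> lbounded a c f ->
  lint a c f = lint a b f + lint b c f.
Proof.
move=> ab bc bf; rewrite (lint_oc (lbounded_sub ab (lexx _) bf)).
rewrite {1}/lint (@itv_bndbnd_setU _ _ _ (BRight b)) ?bnd_simp //.
rewrite Rintegral_setU //.
  rewrite -itv_bndbnd_setU ?bnd_simp //; exact: lbounded_integrable.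
apply/disj_setPS => x [/=]; rewrite !in_itv /= => /andP[_ h1] /andP[h2].
by have := lt_le_trans h2 h1; rewrite ltxx.
Qed.

Lemma lint_dist a b f m e : a <= b -> lbounded a b f ->
  (forall s, a < s < b -> `|f s - m| <= e) ->
  `|lint a b f - m * (b - a)| <= e * (b - a).
Proof.
move=> ab bf fe.
have int_cst n : lint a b (fun=> n) = n * (b - a).
  rewrite /lint Rintegral_cst //; change (n * fine (cmu `[a, b]) = n * (b - a)).
  rewrite cmu_itv /= lte_fin.
  by case: ltgtP ab => //= -> _; rewrite subrr.
have le_lint g h : lbounded a b g -> lbounded a b h ->
    (forall s, a < s < b -> g s <= h s) -> lint a b g <= lint a b h.
  move=> bg bh gh; rewrite !lint_oo //.
  have sub l : lbounded a b l -> cmu.-integrable `]a, b[ (EFin \o l).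
    move=> /lbounded_integrable; apply: integrableS => //.
    exact: subset_itv_oo_cc.
  by apply: le_Rintegral => //; exact: sub.
rewrite ler_distl -mulrBl -mulrDl -!int_cst; apply/andP; split.
  apply: le_lint => //; first exact: lbounded_cst.
  by move=> s /fe; rewrite ler_distl => /andP[].
apply: le_lint => //; first exact: lbounded_cst.
by move=> s /fe; rewrite ler_distl => /andP[].
Qed.

Lemma lint_bound a b f e : a <= b -> lbounded a b f ->
  (forall s, a < s < b -> `|f s| <= e) -> `|lint a b f| <= e * (b - a).
Proof.
move=> ab bf fe; have := @lint_dist a b f 0 e ab bf.
by rewrite mul0r subr0; apply => s hs; rewrite subr0 fe.
Qed.

(** Restricting [f] to [a, b] makes it measurable on the line, so that the
    integral against the image of the measure under a translation makes sense;
    that image is the measure itself. *)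
Lemma lint_shift a b c f : lbounded a b f ->
  lint (a + c) (b + c) (fun s => f (s - c)) = lint a b f.
Proof.
move=> bf.
pose g := (fun x => (f x)%:E) \_ `[a, b].
have mg : @measurable_fun _ _ (lebesgueT R) (\bar R) setT g.
  apply/(measurable_restrictT _ _).1 => //.
  by apply/measurable_EFinP; case: bf.
pose phi (x : lebesgueT R) : lebesgueT R := x - c.
have mphi : measurable_fun setT phi by exact: lebesgue_measurable_shift.
have preE : phi @^-1` `[a, b] = `[a + c, b + c]%classic.
  by apply/seteqP; split => x /=; rewrite !in_itv /= lerBrDr lerBlDr.
have gE x : `[a, b]%classic x -> g x = (f x)%:E.
  by move=> h; rewrite /g patchE mem_set.
have gphi : cmu.-integrable (phi @^-1` `[a, b]) (g \o phi).
  rewrite preE; have := lbounded_integrable (lbounded_shift c bf).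
  apply: eq_integrable => // x.
  by rewrite inE -preE => /gE /= ->.
have := integral_pushforward mphi mg gphi (lebesgueT_itv `[a, b]).
rewrite preE => E; rewrite /lint /Rintegral; congr fine.
transitivity (\int[cmu]_(x in `[(a + c)%R, (b + c)%R]) (g \o phi) x)%E.
  by apply: eq_integral => x; rewrite inE -preE => /gE /= ->.
rewrite -E; transitivity (\int[cmu]_(x in `[a, b]) g x)%E.
  by apply: eq_measure_integral => A _ _; exact: outer_measure_shift.
by apply: eq_integral => x; rewrite inE => /gE.
Qed.

End LebesgueIntegral.

(** * Integrals as functions of their upper bound, and the mean value theorem *)

Section Calculus.
Variable R : realType.
Implicit Types (f g d : R -> R) (a b c : R).

Lemma lint_lipschitz a b s t f M : a <= s -> s <= t -> t <= b ->
  lbounded a b f -> (forall x, a <= x <= b -> `|f x| <= M) ->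
  `|lint a t f - lint a s f| <= M * (t - s).
Proof.
move=> a_s st tb bf fM.
rewrite (lint_split a_s st (lbounded_sub (lexx _) tb bf)) addrC addKr.
apply: lint_bound => //; first exact: lbounded_sub a_s tb bf.
move=> x /andP[h1 h2]; apply: fM.
by rewrite (le_trans a_s (ltW h1)) (le_trans (ltW h2) tb).
Qed.

(** Clamping the upper bound turns continuity on a half-line into plain
    continuity, which composes without side conditions. *)
Lemma lint_clamp_continuous a f : (forall b, lbounded a b f) ->
  continuous (fun t => lint a (Num.max a t) f).
Proof.
move=> bf x; pose b := Num.max a x + 1.
have [_ [M0 fM0]] := bf b; pose M := `|M0| + 1.
have M_gt0 : 0 < M by rewrite ltr_wpDl.
have fM y : a <= y <= b -> `|f y| <= M.
  by move=> /fM0 /le_trans; apply; rewrite (le_trans (ler_norm _)) // lerDl.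
have H s t : a <= s -> s <= t -> t <= b ->
    `|lint a t f - lint a s f| <= M * (t - s).
  by move=> h1 h2 h3; exact: lint_lipschitz (bf b) fM.
have mm (y : R) : `|Num.max a x - Num.max a y| <= `|x - y|.
  case: (leP a x) => h1; case: (leP a y) => h2 //; last first.
  - by rewrite subrr normr0.
  - by rewrite distrC (distrC x) !ger0_norm ?subr_ge0; lra.
  - by rewrite !ger0_norm ?subr_ge0; lra.
have L (y : R) : `|x - y| < 1 ->
    `|lint a (Num.max a x) f - lint a (Num.max a y) f| <=
    M * `|Num.max a x - Num.max a y|.
  move=> hy; have := mm y; have ax : a <= Num.max a x by rewrite le_max lexx.
  have ay : a <= Num.max a y by rewrite le_max lexx.
  move: ax ay (erefl b); rewrite {2}/b.
  move: (Num.max a x) (Num.max a y) => p q ap aq bE.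
  have [pq|qp] := leP p q.
    rewrite distrC (distrC (lint _ _ _)) (ger0_norm (_ : 0 <= q - p)) ?subr_ge0 //.
    by move=> h; apply: H => //; lra.
  rewrite (ger0_norm (_ : 0 <= p - q)) ?subr_ge0 ?(ltW qp) // => h.
  by apply: H => //; lra.
apply/cvgrPdist_le => e e0; near=> y.
have hy : `|x - y| < 1.
  by near: y; exists 1 => /=.
have hy2 : `|x - y| < e / M.
  by near: y; exists (e / M); rewrite /= ?divr_gt0.
rewrite (le_trans (L y hy)) // -ler_pdivlMl // mulrC (le_trans (mm y)) //.
exact: ltW.
Unshelve. all: by end_near. Qed.

Lemma is_deriveP f c (l : R) :
  (h^-1 * (f (c + h) - f c) @[h --> (0 : R)^'] --> l) <->
  is_derive c (1 : R) f l.
Proof.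
have E : (fun h : R => h^-1 *: ((f \o shift c) (h *: (1 : R)) - f c)) =
         (fun h => h^-1 * (f (c + h) - f c)).
  by apply/funext => h /=; rewrite [h *: _]mulr1 [h + c]addrC.
split=> [H|[df <-]].
  by apply: DeriveDef; rewrite /derivable /derive E;
    [apply/cvg_ex; exists l|exact: cvg_lim H].
by rewrite -E; exact: df.
Qed.

Lemma is_derive_lint a b c f : a < c -> c < b -> lbounded a b f ->
  {for c, continuous f} -> is_derive c (1 : R) (fun t => lint a t f) (f c).
Proof.
move=> ac cb bf cf; apply/is_deriveP.
apply/cvgrPdist_le => e e0.
have [d /= d0 hd] : \forall x \near c, `|f c - f x| <= e.
  by move/cvgrPdist_le: cf; apply.
near=> h.
have h0 : h != 0 by near: h; exact: nbhs_dnbhs_neq.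
have hd1 : `|h| < d.
  near: h; apply: nbhs_dnbhs; near=> h; rewrite -[h]subr0 distrC.
  by near: h; apply: nbhsx_ballx.
have hac : `|h| < c - a.
  near: h; apply: nbhs_dnbhs; near=> h; rewrite -[h]subr0 distrC.
  by near: h; apply: nbhsx_ballx; rewrite subr_gt0.
have hcb : `|h| < b - c.
  near: h; apply: nbhs_dnbhs; near=> h; rewrite -[h]subr0 distrC.
  by near: h; apply: nbhsx_ballx; rewrite subr_gt0.
(* on the segment between c and c + h the integrand is within e of f c *)
have fe x : `|x - c| <= `|h| -> `|f x - f c| <= e.
  by move=> xh; rewrite distrC; apply: hd; rewrite /= distrC (le_lt_trans xh).
rewrite -(ler_pM2l (_ : 0 < `|h|)) ?normr_gt0 // -normrM mulrBr mulrA divff //.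
rewrite mul1r distrC.
have [h_gt0|h_le0] := ltP 0 h.
  rewrite (gtr0_norm h_gt0) in fe hd1 hac hcb *.
  have ch : c <= c + h by rewrite lerDl ltW.
  have chb : c + h <= b by rewrite -lerBrDl ltW.
  rewrite (lint_split (ltW ac) ch (lbounded_sub (lexx _) chb bf)).
  have := @lint_dist _ c (c + h) f (f c) e ch (lbounded_sub (ltW ac) chb bf).
  rewrite ![c + h - c]addrAC !subrr !add0r ![_ * h]mulrC.
  rewrite [_ + _ - lint a c f]addrAC subrr add0r.
  apply => s /andP[h1 h2].
  by apply: fe; rewrite ger0_norm; lra.
have h_lt0 : h < 0 by rewrite lt_neqAle h0.
rewrite (ltr0_norm h_lt0) in fe hd1 hac hcb *.
have ch : c + h <= c by rewrite gerDl ltW.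
have cha : a <= c + h by rewrite -lerBlDl ltW // -ltrN2 opprB.
rewrite (lint_split cha ch (lbounded_sub (lexx _) (ltW cb) bf)) opprD addNKr.
have := @lint_dist _ (c + h) c f (f c) e ch (lbounded_sub cha (ltW cb) bf).
rewrite opprD addNKr mulrN opprK -opprD normrN [_ * h]mulrC [_ * - h]mulrC.
apply => s /andP[h1 h2].
by apply: fe; rewrite ler0_norm; lra.
Unshelve. all: by end_near. Qed.

(** A singularity of the derivative is removable as soon as the function and
    the candidate derivative are continuous there: by the mean value theorem
    the difference quotient at [c] is a value of [d] at a point closer to [c]. *)
Lemma is_derive_removable f d c :
  {for c, continuous f} -> {for c, continuous d} ->
  (\forall s \near c, s != c -> is_derive s (1 : R) f (d s)) ->
  is_derive c (1 : R) f (d c).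
Proof.
move=> cf cd [e1 /= e10 df]; apply/is_deriveP; apply/cvgrPdist_le => e e0.
have [e2 /= e20 de] : \forall x \near c, `|d c - d x| <= e.
  by move/cvgrPdist_le: cd; apply.
near=> h.
have h0 : h != 0 by near: h; exact: nbhs_dnbhs_neq.
have hd1 : `|h| < e1.
  near: h; apply: nbhs_dnbhs; near=> h; rewrite -[h]subr0 distrC.
  by near: h; apply: nbhsx_ballx.
have hd2 : `|h| < e2.
  near: h; apply: nbhs_dnbhs; near=> h; rewrite -[h]subr0 distrC.
  by near: h; apply: nbhsx_ballx.
have cfs x : `|x - c| <= `|h| -> {for x, continuous f}.
  move=> xh; have [->//|xc] := eqVneq x c.
  have [] := df x; rewrite /= ?(distrC c) ?(le_lt_trans xh) //.
  by move=> /derivable1_diffP/differentiable_continuous.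
suff [s sh ->] : exists2 s, `|s - c| <= `|h| & h^-1 * (f (c + h) - f c) = d s.
  by apply: de; rewrite /= distrC (le_lt_trans sh).
have [h_gt0|h_le0] := ltP 0 h.
  rewrite (gtr0_norm h_gt0) in hd1 hd2 cfs *.
  have ch : c < c + h by rewrite ltrDl.
  have [s|x|s] := @MVT _ f d c (c + h) ch.
  - rewrite in_itv /= => /andP[h1 h2]; apply: df; last by rewrite gt_eqF.
    by rewrite /= distrC gtr0_norm ?subr_gt0 // (lt_trans _ hd1) // ltrBlDl.
  - apply: continuous_in_subspaceT => s; rewrite inE /= in_itv /= => /andP[h1 h2].
    by apply: cfs; rewrite ger0_norm ?subr_ge0 // lerBlDl.
  rewrite in_itv /= => /andP[h1 h2] ->; exists s.
    by rewrite ger0_norm ?subr_ge0 ?lerBlDl // ltW.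
  by rewrite [c + h - c]addrAC subrr add0r mulrCA mulVf // mulr1.
have h_lt0 : h < 0 by rewrite lt_neqAle h0.
rewrite (ltr0_norm h_lt0) in hd1 hd2 cfs *.
have ch : c + h < c by rewrite gtrDl.
have [s|x|s] := @MVT _ f d (c + h) c ch.
- rewrite in_itv /= => /andP[h1 h2]; apply: df; last by rewrite lt_eqF.
  rewrite /= gtr0_norm ?subr_gt0 // (lt_trans _ hd1) //.
  by lra.
- apply: continuous_in_subspaceT => s; rewrite inE /= in_itv /= => /andP[h1 h2].
  by apply: cfs; rewrite ler0_norm ?subr_le0 // opprB; lra.
rewrite in_itv /= => /andP[h1 h2] E; exists s.
  by rewrite ler0_norm ?subr_le0 ?(ltW h2) // opprB; lra.
have -> : f (c + h) - f c = d s * h by rewrite -opprB E; ring.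
by rewrite mulrCA mulVf // mulr1.
Unshelve. all: by end_near. Qed.

Lemma eq_derive_eq f g d a b : a <= b ->
  {within `[a, b], continuous f} -> {within `[a, b], continuous g} ->
  (forall s, a < s < b -> is_derive s (1 : R) f (d s)) ->
  (forall s, a < s < b -> is_derive s (1 : R) g (d s)) ->
  f a = g a -> f b = g b.
Proof.
rewrite le_eqVlt => /orP[/eqP <- //|ab] cf cg df dg fga.
have [s|x|s _] := @MVT _ (fun x => f x - g x) (fun=> 0) a b ab.
- rewrite in_itv /= => h; have Df := df s h; have Dg := dg s h.
  by apply: is_derive_eq; rewrite subrr.
- by apply: continuousB; [exact: cf|exact: cg].
by rewrite mul0r fga subrr subr0 => /subr0_eq.
Qed.

End Calculus.

(** * Vectors and the change of coordinates *)

Section Vectors.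
Variable R : realType.
Implicit Types (a b th : R -> R) (t : R).

Lemma vec3E (a b c : R) :
  (vec3 a b c 0 0 = a) * (vec3 a b c 0 1 = b) * (vec3 a b c 0 2 = c).
Proof. by rewrite /vec3 !mxE. Qed.

Lemma ord3_ind (P : 'I_3 -> Prop) : P 0 -> P 1 -> P 2 -> forall j, P j.
Proof.
move=> P0 P1 P2 [[|[|[|//]]] h].
- by rewrite (_ : Ordinal h = 0) //; apply: val_inj.
- by rewrite (_ : Ordinal h = 1) //; apply: val_inj.
- by rewrite (_ : Ordinal h = 2) //; apply: val_inj.
Qed.

Lemma ord2_ind (P : 'I_2 -> Prop) : P 0 -> P 1 -> forall j, P j.
Proof.
move=> P0 P1 [[|[|//]] h].
- by rewrite (_ : Ordinal h = 0) //; apply: val_inj.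
- by rewrite (_ : Ordinal h = 1) //; apply: val_inj.
Qed.

Lemma vec3_eta (x : 'rV[R]_3) : vec3 (x 0 0) (x 0 1) (x 0 2) = x.
Proof. by apply/rowP; apply: ord3_ind; rewrite vec3E. Qed.

Lemma zetaK : involutive (@zeta R).
Proof.
move=> z; rewrite -[RHS]vec3_eta /zeta !vec3E.
by congr (vec3 _ _ _); rewrite -[RHS]mulr1 -(cos2Dsin2 (z 0 2)); ring.
Qed.

Section Enorm.
Variable n : nat.
Implicit Type x : 'rV[R]_n.

Lemma enorm_ge0 x : 0 <= enorm x. Proof. exact: sqrtr_ge0. Qed.

Lemma enorm_coord x j : `|x 0 j| <= enorm x.
Proof.
rewrite -sqrtr_sqr ler_wsqrtr // (bigD1 j) //= lerDl sumr_ge0 // => i _.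
exact: sqr_ge0.
Qed.

Lemma enorm_eq0 x : enorm x <= 0 -> x = 0.
Proof.
move=> x0; apply/rowP => j; rewrite mxE; apply/eqP.
by rewrite -normr_le0 (le_trans (enorm_coord x j)).
Qed.

Lemma enorm_le_sum x : enorm x <= \sum_j `|x 0 j|.
Proof.
have s0 : 0 <= \sum_j `|x 0 j| by exact: sumr_ge0.
rewrite -(ger0_norm s0) -sqrtr_sqr ler_wsqrtr // expr2 big_distrl /=.
apply: ler_sum => i _; rewrite -real_normK ?num_real // expr2.
by rewrite ler_wpM2l // (bigD1 i) //= lerDl sumr_ge0.
Qed.

Lemma enorm_le_coord x (e : R) : (forall j, `|x 0 j| <= e) -> enorm x <= n%:R * e.
Proof.
move=> xe; rewrite (le_trans (enorm_le_sum x)) //.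
rewrite (le_trans (ler_sum _ (fun j _ => xe j))) // sumr_const card_ord.
by rewrite mulr_natl.
Qed.

End Enorm.

(** In the plane [zeta] is a reflection whose axis depends on the heading. *)
Lemma enorm_zeta (z : 'rV[R]_3) : enorm (zeta z) = enorm z.
Proof.
rewrite /enorm !big_ord_recr !big_ord0 /= /zeta !add0r.
have E (x : 'rV[R]_3) : (x ord0 (widen_ord (leqnSn 2) (widen_ord (leqnSn 1) ord_max))
    = x 0 0) * (x ord0 (widen_ord (leqnSn 2) ord_max) = x 0 1) * (x ord0 ord_max = x 0 2).
  by split; [split|]; congr (x _ _); apply: val_inj.
rewrite !E !vec3E; congr Num.sqrt.
have := cos2Dsin2 (z 0 2); move: (cos _) (sin _) (z 0 0) (z 0 1) => c s x y h.
congr (_ + _); rewrite -[RHS]mul1r -h; ring.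
Qed.

Lemma cvg_row (n : nat) (T : Type) (F : set_system T) {FF : Filter F}
    (f : T -> 'rV[R]_n) (l : 'rV[R]_n) :
  (forall j, f t 0 j @[t --> F] --> l 0 j) -> f t @[t --> F] --> l.
Proof.
move=> fl; apply/cvg_ballP => e e0.
have H : \forall t \near F, forall j : 'I_n, ball (l 0 j) e (f t 0 j).
  by apply: filter_forall => j; move/cvg_ballP : (fl j); apply.
near=> t; split=> // i j; rewrite !ord1; move: j; near: t; exact: H.
Unshelve. all: by end_near. Qed.

Lemma cvg_coord (n : nat) (T : Type) (F : set_system T) {FF : Filter F}
    (f : T -> 'rV[R]_n) (l : 'rV[R]_n) j :
  f t @[t --> F] --> l -> f t 0 j @[t --> F] --> l 0 j.
Proof.
move=> fl; exact: (continuous_cvg FF (@coord_continuous R 1 n 0 j l) fl).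
Qed.

Lemma is_derive_rot1 a b th (a' b' th' : R) t :
  is_derive t (1 : R) a a' -> is_derive t (1 : R) b b' ->
  is_derive t (1 : R) th th' ->
  is_derive t (1 : R) (fun s => a s * cos (th s) + b s * sin (th s))
    (a' * cos (th t) - a t * sin (th t) * th' +
     (b' * sin (th t) + b t * cos (th t) * th')).
Proof.
move=> da db dth.
have dc : is_derive t (1 : R) (fun s => cos (th s)) (- sin (th t) * th').
  exact: (is_derive1_comp (f := cos)).
have ds : is_derive t (1 : R) (fun s => sin (th s)) (cos (th t) * th').
  exact: (is_derive1_comp (f := sin)).
by apply: is_derive_eq; rewrite /GRing.scale /=; ring.
Qed.

Lemma is_derive_rot2 a b th (a' b' th' : R) t :
  is_derive t (1 : R) a a' -> is_derive t (1 : R) b b' ->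
  is_derive t (1 : R) th th' ->
  is_derive t (1 : R) (fun s => a s * sin (th s) - b s * cos (th s))
    (a' * sin (th t) + a t * cos (th t) * th' -
     (b' * cos (th t) - b t * sin (th t) * th')).
Proof.
move=> da db dth.
have dc : is_derive t (1 : R) (fun s => cos (th s)) (- sin (th t) * th').
  exact: (is_derive1_comp (f := cos)).
have ds : is_derive t (1 : R) (fun s => sin (th s)) (cos (th t) * th').
  exact: (is_derive1_comp (f := sin)).
by apply: is_derive_eq; rewrite /GRing.scale /=; ring.
Qed.

(** In the coordinates [zeta] the vehicle becomes the chained system once the
    forward speed is compensated for the lateral drift. *)
Lemma zeta_vehicle (z : R -> 'rV[R]_3) t (u w : 'rV[R]_2) :
  u 0 1 = w 0 1 ->
  u 0 0 = w 0 0 + (z t 0 0 * sin (z t 0 2) - z t 0 1 * cos (z t 0 2)) * u 0 1 ->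
  solves_at z t (vehicle_field (z t) u) ->
  solves_at (fun s => zeta (z s)) t (chained_field (zeta (z t)) w).
Proof.
move=> u1 u0 dz.
have d0 : is_derive t (1 : R) (fun s => z s 0 0) (u 0 0 * cos (z t 0 2)).
  by have := dz 0; rewrite vec3E.
have d1 : is_derive t (1 : R) (fun s => z s 0 1) (u 0 0 * sin (z t 0 2)).
  by have := dz 1; rewrite vec3E.
have d2 : is_derive t (1 : R) (fun s => z s 0 2) (u 0 1).
  by have := dz 2; rewrite vec3E.
rewrite /zeta /chained_field; apply: ord3_ind; rewrite ?vec3E.
- under eq_fun do rewrite vec3E.
  apply: is_derive_eq (is_derive_rot1 d0 d1 d2) _.
  transitivity (u 0 0 * (cos (z t 0 2) ^+ 2 + sin (z t 0 2) ^+ 2) -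
    (z t 0 0 * sin (z t 0 2) - z t 0 1 * cos (z t 0 2)) * u 0 1); first by ring.
  by rewrite cos2Dsin2 u0; ring.
- under eq_fun do rewrite vec3E.
  apply: is_derive_eq (is_derive_rot2 d0 d1 d2) _.
  by rewrite -u1; ring.
- under eq_fun do rewrite vec3E.
  by rewrite -u1.
Qed.

(** The converse direction, used to build a solution: as [zeta] is an involution
    it also carries chained trajectories to vehicle trajectories. *)
Lemma zeta_chained (y : R -> 'rV[R]_3) t (u w : 'rV[R]_2) :
  u 0 1 = w 0 1 -> u 0 0 = w 0 0 + y t 0 1 * w 0 1 ->
  solves_at y t (chained_field (y t) w) ->
  solves_at (fun s => zeta (y s)) t (vehicle_field (zeta (y t)) u).
Proof.
move=> u1 u0 dy.
have d0 : is_derive t (1 : R) (fun s => y s 0 0) (w 0 0).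
  by have := dy 0; rewrite vec3E.
have d1 : is_derive t (1 : R) (fun s => y s 0 1) (y t 0 0 * w 0 1).
  by have := dy 1; rewrite vec3E.
have d2 : is_derive t (1 : R) (fun s => y s 0 2) (w 0 1).
  by have := dy 2; rewrite vec3E.
rewrite /zeta /vehicle_field; apply: ord3_ind; rewrite ?vec3E.
- under eq_fun do rewrite vec3E.
  apply: is_derive_eq (is_derive_rot1 d0 d1 d2) _.
  by rewrite u0; ring.
- under eq_fun do rewrite vec3E.
  apply: is_derive_eq (is_derive_rot2 d0 d1 d2) _.
  by rewrite u0; ring.
- under eq_fun do rewrite vec3E.
  by rewrite u1.
Qed.

Lemma zeta_continuous : continuous (@zeta R).
Proof.
move=> z; apply: (cvg_row (F := nbhs z)).
have c j : (z' : 'rV[R]_3) 0 j @[z' --> z] --> z 0 j by exact: coord_continuous.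
have cc : cos ((z' : 'rV[R]_3) 0 2) @[z' --> z] --> cos (z 0 2).
  by apply: (cvg_comp _ _ (c 2)); exact: continuous_cos.
have cs : sin ((z' : 'rV[R]_3) 0 2) @[z' --> z] --> sin (z 0 2).
  by apply: (cvg_comp _ _ (c 2)); exact: continuous_sin.
rewrite /zeta; elim/ord3_ind; rewrite ?vec3E; under eq_fun do rewrite vec3E.
- by apply: cvgD; apply: cvgM.
- by apply: cvgB; apply: cvgM.
- exact: c.
Qed.

Lemma is_derive_shift (f : R -> R) (c t d : R) :
  is_derive t (1 : R) f d -> is_derive (t + c) (1 : R) (fun s => f (s - c)) d.
Proof.
move/is_deriveP => H; apply/is_deriveP.
rewrite addrK; have E h : t + c + h - c = t + h by ring.
by under eq_fun do rewrite E.
Qed.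

Lemma solves_at_shift n (y : R -> 'rV[R]_n) (c t : R) d :
  solves_at y t d -> solves_at (fun s => y (s - c)) (t + c) d.
Proof. by move=> dy j; apply: (is_derive_shift c (dy j)). Qed.

Lemma solves_at_eq n (x y : R -> 'rV[R]_n) (t : R) d :
  (\forall s \near t, x s = y s) -> solves_at x t d -> solves_at y t d.
Proof.
move=> xy dx j; apply: near_eq_is_derive (dx j).
by near=> s; rewrite (near xy s).
Unshelve. all: by end_near. Qed.

End Vectors.

(** A linear map on [R * 'rV_n] is a combination of the finitely many
    coordinates. *)
Lemma linear_increment_cvg0 (R : realType) n m
    (L : {linear (R * 'rV[R]_n)%type -> 'rV[R]_m}) (p : R * 'rV[R]_n) :
  L (q - p) @[q --> p] --> (0 : 'rV[R]_m).
Proof.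
have pe (u v : R * 'rV[R]_n) : u.1 = v.1 -> u.2 = v.2 -> u = v.
  by case: u v => [? ?] [? ?] /= -> ->.
have LE h : L h = h.1 *: L (1, 0) + \sum_j h.2 0 j *: L (0, delta_mx 0 j).
  under eq_bigr do rewrite -linearZ.
  rewrite -linearZ -linear_sum -linearD; congr (L _).
  rewrite [LHS](_ : _ = h.1 *: (1, 0) + (0, h.2)); last first.
    by apply: pe; rewrite /= ?addr0 ?scaler0 ?add0r // [_ *: 1]mulr1.
  congr (_ + _); rewrite {1}(row_sum_delta h.2).
  rewrite (big_morph (fun v => (0 : R, v)) (id1 := 0) (op1 := +%R)) //.
    by apply: eq_bigr => j _; apply: pe => //=; rewrite [_ *: 0]mulr0.
  by move=> u v; apply: pe => //=; rewrite addr0.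
have c1 : (q.1 - p.1) @[q --> p] --> (0 : R).
  by rewrite -(subrr p.1); apply: cvgB; [exact: cvg_fst|exact: cvg_cst].
have c2 j : ((q : R * 'rV[R]_n).2 0 j - p.2 0 j) @[q --> p] --> (0 : R).
  rewrite -(subrr (p.2 0 j)); apply: cvgB; last exact: cvg_cst.
  by apply: (@cvg_coord R n _ (nbhs p) _ snd p.2 j); exact: cvg_snd.
rewrite (_ : (fun q => L (q - p)) = (fun q => (q.1 - p.1) *: L (1, 0) +
    \sum_j (q.2 0 j - p.2 0 j) *: L (0, delta_mx 0 j))); last first.
  apply/funext => q; rewrite LE /=; congr (_ + _); apply: eq_bigr => j _.
  by rewrite !mxE.
have s1 : (q.1 - p.1) *: L (1, 0) @[q --> p] --> (0 : 'rV[R]_m).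
  by rewrite -(scale0r (L (1, 0))); apply: cvgZr_tmp.
have s2 : (\sum_j ((q : R * 'rV[R]_n).2 0 j - p.2 0 j) *: L (0, delta_mx 0 j))
    @[q --> p] --> (0 : 'rV[R]_m).
  elim: (index_enum _) => [|j s IHs].
    by under eq_fun do rewrite big_nil; exact: cvg_cst.
  under eq_fun do rewrite big_cons.
  have s2 : ((q : R * 'rV[R]_n).2 0 j - p.2 0 j) *: L (0, delta_mx 0 j)
      @[q --> p] --> (0 : 'rV[R]_m).
    by rewrite -(scale0r (L (0, delta_mx 0 j))); apply: cvgZr_tmp.
  by have := cvgD s2 IHs; rewrite addr0; apply.
by have := cvgD s1 s2; rewrite addr0; apply.
Qed.

(** Clamping the time to the half-line gives a function that is continuous on
    the whole space, also at the boundary where the derivative is one-sided. *)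
Lemma C1_halfspace_continuous (R : realType) n m (f : R -> 'rV[R]_n -> 'rV[R]_m) :
  C1_halfspace f ->
  continuous (fun p : R * 'rV[R]_n => f (Num.max 0 p.1) p.2).
Proof.
move=> [df [dfP _]] p; set D := [set _ | _] in dfP.
pose cl (q : R * 'rV[R]_n) : R * 'rV[R]_n := (Num.max 0 q.1, q.2).
have Dcl q : D (cl q) by rewrite /D /= le_max lexx.
have ccl : cl q @[q --> p] --> cl p.
  apply: (@cvg_pair _ _ _ _ (nbhs (cl p).1) (nbhs (cl p).2)); last exact: cvg_snd.
  by apply: (continuous_max (x := p)); [exact: cvg_cst|exact: cvg_fst].
have ccl' : cl q @[q --> p] --> within D (nbhs (cl p)).
  by move=> A h; apply: (@filterS _ (nbhs p) _ _ _ _ (ccl _ h)) => q; apply; exact: Dcl.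
pose L := df (cl p).
have cL := linear_increment_cvg0 L (cl p).
apply: (cvg_comp _ (fun q => f q.1 q.2) ccl').
have -> : (fun q => f q.1 q.2) = (fun q : R * 'rV_n =>
   (f q.1 q.2 - f (cl p).1 (cl p).2 - L (q - cl p)) +
   (f (cl p).1 (cl p).2 + L (q - cl p))).
  by apply/funext => q; rewrite addrACA subrK addrA subrK.
have B : L (q - cl p) @[q --> within D (nbhs (cl p))] --> (0 : 'rV[R]_m).
  exact: cvg_within_filter.
have A : (f q.1 q.2 - f (cl p).1 (cl p).2 - L (q - cl p))
    @[q --> within D (nbhs (cl p))] --> (0 : 'rV[R]_m).
  apply/cvgr0Pnorm_le => e e0; near=> q.
  have h1 : `|q - cl p| <= 1.
    rewrite distrC; near: q; apply: cvg_within.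
    apply: (@cvgr_dist_le _ _ _ (nbhs (cl p)) _ id (cl p)) => //.
  apply: (@le_trans _ _ (e * `|q - cl p|)); last by rewrite ger_pMr.
  near: q; exact: dfP.
have := cvgD A (cvgD (cvg_cst (f (cl p).1 (cl p).2)) B).
by rewrite add0r addr0; apply.
Unshelve. all: by end_near. Qed.

(** * Gains and comparison functions *)

Section Gains.
Variable R : realType.
Implicit Types (g : R -> R) (s t : R).

Definition pos s : R := Num.max 0 s.

Lemma pos_ge0 s : 0 <= pos s. Proof. by rewrite /pos le_max lexx. Qed.

Lemma pos_id s : 0 <= s -> pos s = s. Proof. by move=> ?; apply/max_idPr. Qed.

Lemma pos_eq0 s : s <= 0 -> pos s = 0. Proof. by move=> ?; apply/max_idPl. Qed.

Lemma ler_pos s t : s <= t -> pos s <= pos t.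
Proof. by move=> st; rewrite /pos; case: (leP 0 s); case: (leP 0 t); lra. Qed.

Lemma pos_continuous : continuous pos.
Proof.
by move=> x; apply: (continuous_max (x := x)); [exact: cvg_cst|exact: cvg_id].
Qed.

(** Gains live on the whole line and vanish on the negative half, so that sums,
    products and composites of gains are gains without side conditions. *)
Definition gain g := [/\ continuous g, {homo g : s t / s <= t} &
  forall s, s <= 0 -> g s = 0].

Lemma gain_ge0 g s : gain g -> 0 <= g s.
Proof.
move=> [_ gm g0]; have [s0|s0] := leP s 0; first by rewrite g0.
by rewrite -(g0 0 (lexx _)) gm // ltW.
Qed.

Lemma gain_pos : gain pos.
Proof. by split; [exact: pos_continuous|exact: ler_pos|exact: pos_eq0]. Qed.

Lemma gainD g h : gain g -> gain h -> gain (fun s => g s + h s).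
Proof.
move=> [gc gm g0] [hc hm h0]; split.
- by move=> x; apply: cvgD; [exact: gc|exact: hc].
- by move=> s t st; rewrite lerD ?gm ?hm.
- by move=> s s0; rewrite g0 // h0 // addr0.
Qed.

Lemma gainM g h : gain g -> gain h -> gain (fun s => g s * h s).
Proof.
move=> gg gh; have [gc gm g0] := gg; have [hc hm h0] := gh; split.
- by move=> x; apply: cvgM; [exact: gc|exact: hc].
- by move=> s t st; rewrite ler_pM ?gm ?hm // gain_ge0.
- by move=> s s0; rewrite g0 // mul0r.
Qed.

Lemma gainZ (c : R) g : 0 <= c -> gain g -> gain (fun s => c * g s).
Proof.
move=> c0 [gc gm g0]; split.
- by move=> x; apply: cvgM; [exact: cvg_cst|exact: gc].
- by move=> s t st; rewrite ler_wpM2l // gm.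
- by move=> s s0; rewrite g0 // mulr0.
Qed.

Lemma gain_comp g h : gain g -> gain h -> gain (fun s => g (h s)).
Proof.
move=> [gc gm g0] [hc hm h0]; split.
- by move=> x; apply: (continuous_comp (f := h) (g := g)); [exact: hc|exact: gc].
- by move=> s t st; rewrite gm // hm.
- by move=> s s0; rewrite h0 // g0.
Qed.

Section KL.
Variable sigma : R -> R -> R.
Hypothesis sigmaKL : class_KL sigma.

Lemma KL_le s1 s2 t : 0 <= t -> 0 <= s1 -> s1 <= s2 -> sigma s1 t <= sigma s2 t.
Proof.
have [_ _ sm _ _] := sigmaKL => t0 s10; rewrite le_eqVlt => /orP[/eqP->//|s12].
by apply/ltW/sm.
Qed.

Lemma KL_ge0 s t : 0 <= t -> 0 <= s -> 0 <= sigma s t.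
Proof.
by have [_ s0 _ _ _] := sigmaKL => t0 h; rewrite -(s0 t t0) KL_le.
Qed.

Lemma KL_pos_continuous : continuous (fun p : R * R => sigma (pos p.1) (pos p.2)).
Proof.
have [cs _ _ _ _] := sigmaKL; set D := [set _ | _] in cs.
pose cl (q : R * R) : R * R := (pos q.1, pos q.2).
have Dcl q : D (cl q) by split; exact: pos_ge0.
move=> p; have ccl : cl q @[q --> p] --> cl p.
  apply: (@cvg_pair _ _ _ _ (nbhs (cl p).1) (nbhs (cl p).2)).
    apply: (@continuous_cvg _ _ _ (nbhs p) _ fst pos); first exact: pos_continuous.
    exact: cvg_fst.
  apply: (@continuous_cvg _ _ _ (nbhs p) _ snd pos); first exact: pos_continuous.
  exact: cvg_snd.
have ccl' : cl q @[q --> p] --> within D (nbhs (cl p)).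
  by move=> A h; apply: (@filterS _ (nbhs p) _ _ _ _ (ccl _ h)) => q; apply.
move/subspace_continuousP: cs => /(_ (cl p) (Dcl p)) cs.
exact: (cvg_comp _ _ ccl' cs).
Qed.

Lemma gain_KL0 : gain (fun s => sigma (pos s) 0).
Proof.
split.
- move=> s; have E : (fun s => sigma (pos s) 0) =
      (fun p : R * R => sigma (pos p.1) (pos p.2)) \o (fun s => (s, 0)).
    by apply/funext => x /=; rewrite (pos_id (lexx 0)).
  rewrite E; apply: continuous_comp; last exact: KL_pos_continuous.
  apply: (@cvg_pair _ _ _ _ (nbhs s) (nbhs 0)); [exact: cvg_id|exact: cvg_cst].
- by move=> s t st; rewrite KL_le ?pos_ge0 ?ler_pos.
- by have [_ s0 _ _ _] := sigmaKL => s /pos_eq0 ->; rewrite s0.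
Qed.

(** An estimate that is only available after a dead time [L] still has the KL
    form: before [L] a bound by a gain [a] is absorbed in the exponential. *)
Lemma KL_delay (g1 g2 a : R -> R) (L : R) : 0 <= L ->
  gain g1 -> gain g2 -> gain a ->
  class_KL (fun s t => g1 (sigma (g2 s) (pos (t - L))) + (a s + s) * expR (L - t)).
Proof.
move=> L0 gg1 gg2 ga; have [sc s0 sm st sl] := sigmaKL.
have [g1c g1m g10] := gg1; have [g2c g2m g20] := gg2; have [ac am a0] := ga.
split.
- apply: continuous_subspaceT => p.
  have c1 : g2 q.1 @[q --> p] --> g2 p.1.
    apply: (@continuous_cvg _ _ _ (nbhs p) _ fst g2); first exact: g2c.
    exact: cvg_fst.
  have c2 : (q.2 - L) @[q --> p] --> (p.2 - L).
    by apply: cvgB; [exact: cvg_snd|exact: cvg_cst].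
  have c3 : sigma (g2 q.1) (pos (q.2 - L)) @[q --> p] -->
      sigma (g2 p.1) (pos (p.2 - L)).
    have c4 : (g2 q.1, q.2 - L) @[q --> p] --> (g2 p.1, p.2 - L).
      exact: (@cvg_pair _ _ _ _ (nbhs (g2 p.1)) (nbhs (p.2 - L))).
    have := cvg_comp _ _ c4 (@KL_pos_continuous (g2 p.1, p.2 - L)).
    have pg x : pos (g2 x) = g2 x by rewrite pos_id // gain_ge0.
    by rewrite /comp /= pg; under eq_fun do rewrite pg.
  apply: cvgD.
    apply: (@continuous_cvg _ _ _ (nbhs p) _ _ g1) c3; exact: g1c.
  apply: cvgM.
    apply: cvgD; last exact: cvg_fst.
    apply: (@continuous_cvg _ _ _ (nbhs p) _ fst a); first exact: ac.
    exact: cvg_fst.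
  apply: (@continuous_cvg _ _ _ (nbhs p) _ _ expR); first exact: continuous_expR.
  by apply: cvgB; [exact: cvg_cst|exact: cvg_snd].
- move=> t t0; rewrite g20 // s0 ?pos_ge0 // g10 // a0 //; ring.
- move=> t s1 s2 t0 s10 s12; apply: ler_ltD.
    by rewrite g1m // KL_le ?pos_ge0 ?(gain_ge0 _ gg2) // g2m // ltW.
  by rewrite ltr_pM2r ?expR_gt0 // ler_ltD // am // ltW.
- move=> s t1 t2 h t10 t12; apply: lerD.
    rewrite g1m // st ?pos_ge0 ?(gain_ge0 _ gg2) // ler_pos //; lra.
  rewrite ler_wpM2l ?addr_ge0 ?(gain_ge0 _ ga) // ler_expR; lra.
- move=> s h.
  have c1 : sigma (g2 s) (pos (t - L)) @[t --> +oo] --> (0 : R).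
    have := sl _ (gain_ge0 s gg2).
    apply: cvg_comp => A [M [Mr MA]]; exists (`|M| + L); split; first exact: num_real.
    move=> x xM; apply: MA; have := ler_norm M; have := normr_ge0 M => ? ?.
    by rewrite pos_id; lra.
  have c2 : expR (L - t) @[t --> +oo] --> (0 : R).
    have := @cvgr_expR R.
    have E : (fun t : R => expR (L - t)) = (fun t => expR (- t)) \o (fun t => t - L).
      by apply/funext => x /=; rewrite opprB.
    rewrite E; apply: cvg_comp => A [M [Mr MA]]; exists (M + L).
    by split; [exact: num_real|move=> x xM; apply: MA; lra].
  have c3 : g1 (sigma (g2 s) (pos (t - L))) @[t --> +oo] --> g1 0.
    exact: (cvg_comp _ _ c1 (g1c 0)).
  have := cvgD c3 (cvgM (cvg_cst (a s + s)) c2).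
  by rewrite g10 // mulr0 addr0; exact.
Qed.

End KL.

(** The supremum of a jointly continuous function over a compact set depends
    continuously on the parameter, and the feedback is periodic, so its supremum
    over [0, P] and the ball of radius [s] is a gain.  The ball is parametrised
    by the unit cube, which makes the compact set independent of [s]. *)
Lemma feedback_gain (k : R -> 'rV[R]_3 -> 'rV[R]_2) :
  C1_halfspace k -> (forall t, 0 <= t -> k t 0 = 0) -> time_periodic k ->
  exists2 beta, gain beta &
    forall t x s j, 0 <= t -> enorm x <= s -> `|k t x 0 j| <= beta s.
Proof.
move=> /C1_halfspace_continuous Kc k0 [P P0 kP].
pose h (u : 'rV[R]_2) := `|u 0 0| + `|u 0 1|.
have hc : continuous h.
  move=> u; have c j : `|(v : 'rV[R]_2) 0 j| @[v --> u] --> `|u 0 j|.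
    apply: (@continuous_cvg _ _ _ (nbhs u) _ (fun v : 'rV[R]_2 => v 0 j) Num.norm).
      exact: norm_continuous.
    exact: coord_continuous.
  exact: (cvgD (c 0) (c 1)).
have h_ge0 u : 0 <= h u by rewrite addr_ge0.
(* the feedback on the ball of radius s, pulled back to the unit cube *)
pose G s (q : R * 'rV[R]_3) := h (k (Num.max 0 q.1) (pos s *: q.2)).
have Gc : continuous (fun p : R * (R * 'rV[R]_3) => G p.1 p.2).
  move=> p; pose f (q : R * (R * 'rV[R]_3)) : R * 'rV[R]_3 := (q.2.1, pos q.1 *: q.2.2).
  have fc : f q @[q --> p] --> f p.
    have c2 : q.2 @[q --> p] --> p.2 by exact: cvg_snd.
    apply: (@cvg_pair _ _ _ _ (nbhs p.2.1) (nbhs (pos p.1 *: p.2.2))).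
      by apply: (cvg_comp _ _ c2); exact: cvg_fst.
    apply: cvgZ; last by apply: (cvg_comp _ _ c2); exact: cvg_snd.
    apply: (@continuous_cvg _ _ _ (nbhs p) _ fst pos); first exact: pos_continuous.
    exact: cvg_fst.
  have := cvg_comp _ _ (cvg_comp _ _ fc (Kc (f p))) (hc (k (Num.max 0 (f p).1) (f p).2)).
  exact.
have GcE s q e : 0 < e -> exists2 A : set R * set (R * 'rV[R]_3),
    nbhs s A.1 /\ nbhs q A.2 & forall s' q', A.1 s' -> A.2 q' -> `|G s q - G s' q'| < e.
  move=> e0; have /cvgrPdist_lt/(_ e e0) [A [A1 A2] AG] := Gc (s, q).
  by exists A => // s' q' h1 h2; exact: (AG (s', q')).
pose C : set (R * 'rV[R]_3) :=
  `[0, P]%classic `*` [set w : 'rV[R]_3 | forall i, `[-1, 1]%classic (w ord0 i)].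
have Ccomp : compact C.
  apply: compact_setX; first exact: segment_compact.
  apply: (@rV_compact R 3 (fun=> `[-1, 1]%classic)) => i; exact: segment_compact.
have C0 : C (0, 0).
  split; first by rewrite /= in_itv /= lexx ltW.
  by move=> i; rewrite /= mxE in_itv /= lerN10 ler01.
have Gbd s : has_sup [set G s q | q in C].
  split; first by exists (G s (0, 0)), (0, 0).
  have : compact [set G s q | q in C].
    apply: continuous_compact => //; apply: continuous_subspaceT => q.
    apply/cvgrPdist_lt => e /(GcE s q)[A [A1 A2] AG].
    by near=> q'; apply: AG; [exact: nbhs_singleton|near: q'].
  move=> /compact_bounded [M [_ MG]]; exists (M + 1) => x Gx.
  by apply: (le_trans (ler_norm x)); apply: MG => //; rewrite ltrDl.
pose beta s := sup [set G s q | q in C].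
have Gbeta s q : C q -> G s q <= beta s.
  by move=> Cq; apply: sup_upper_bound => //; exists q.
have betaG s M : (forall q, C q -> G s q <= M) -> beta s <= M.
  move=> GM; apply: sup_le_ub; first by exists (G s (0, 0)), (0, 0).
  by move=> _ [q Cq <-]; exact: GM.
exists beta; first split.
- move=> s0; apply/cvgrPdist_le => e e0.
  have H : \forall s \near s0, C `<=` (fun q => `|G s0 q - G s q| <= e).
    have := (compact_near_coveringP C).1 Ccomp R (nbhs s0)
      (fun s q => `|G s0 q - G s q| <= e) _.
    apply => q Cq.
    have [A [A1 A2] AG] := GcE s0 q (e / 2) (divr_gt0 e0 (ltr0Sn _ 1)).
    exists (A.2, A.1) => // -[q' s] /= [h2 h1].
    have := AG _ _ h1 h2; have := AG _ _ (nbhs_singleton A1) h2.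
    by move: e e0 {AG A A1 A2 h1 h2} => e e0; rewrite ler_distl !ltr_distl; lra.
  apply: filterS H => s H.
  rewrite ler_distlC; apply/andP; split.
    rewrite lerBlDr; apply: betaG => q Cq; have := H q Cq; have := Gbeta s q Cq.
    by rewrite ler_distl; lra.
  apply: betaG => q Cq; have := H q Cq; have := Gbeta s0 q Cq.
  by rewrite ler_distl; lra.
- (* a point of the smaller ball is a point of the larger one, rescaled *)
  move=> s s' ss'; apply: betaG => -[t w] [/= ht hw].
  have [s'0|s'0] := leP s' 0.
    rewrite (_ : G s (t, w) = G s' (t, w)); first exact: Gbeta.
    by rewrite /G !pos_eq0 // (le_trans ss').
  have ps : 0 < pos s' by rewrite pos_id // ltW.
  have -> : G s (t, w) = G s' (t, (pos s / pos s') *: w).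
    by rewrite /G /= scalerA mulrCA divff ?gt_eqF // mulr1.
  apply: Gbeta; split => //= i; have := hw i; rewrite mxE /= !in_itv /= -!ler_norml => hi.
  rewrite normrM -[leRHS]mulr1 ler_pM // ger0_norm ?divr_ge0 ?pos_ge0 //.
  by rewrite ler_pdivrMr // mul1r ler_pos.
- move=> s s0; apply/eqP; rewrite eq_le; apply/andP; split.
    apply: betaG => q _; rewrite /G pos_eq0 // scale0r k0 ?le_max ?lexx //.
    by rewrite /h !mxE normr0 addr0.
  by rewrite (le_trans _ (Gbeta s (0, 0) C0)) //; exact: h_ge0.
move=> t x s j t0 xs.
(* reduce t to [0, P] by periodicity, then x to the cube by scaling *)
have kn n u : 0 <= u -> k (u + n%:R * P) x = k u x.
  move=> u0; elim: n => [|n IH]; first by rewrite mul0r addr0.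
  rewrite -IH -(kP (u + n%:R * P)) ?addr_ge0 ?mulr_ge0 ?ler0n ?(ltW P0) //.
  by rewrite -natr1 mulrDl mul1r addrA.
have [t' [t'0 t'P] ->] : exists2 t', 0 <= t' /\ t' <= P & k t x = k t' x.
  have h1 := truncn_itv (divr_ge0 t0 (ltW P0)).
  move: h1; set n := Num.trunc _; rewrite ler_pdivlMr // ltr_pdivrMr // -natr1.
  move=> /andP[h1 h2]; exists (t - n%:R * P); first by split; lra.
  by rewrite -[RHS](kn n) ?subrK //; lra.
have s_ge0 : 0 <= s := le_trans (enorm_ge0 x) xs.
apply: (@le_trans _ _ (h (k t' x))).
  by elim/ord2_ind: j; rewrite /h ?lerDl ?lerDr.
move: s_ge0; rewrite le_eqVlt => /orP[/eqP s0|s_gt0].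
  move: xs; rewrite -s0 => /enorm_eq0 ->; rewrite k0 // /h !mxE normr0 addr0.
  by rewrite (le_trans _ (Gbeta 0 (0, 0) C0)) //; exact: h_ge0.
have -> : k t' x = k (Num.max 0 t') (pos s *: (s^-1 *: x)).
  by rewrite pos_id ?ltW // scalerA divff ?gt_eqF // scale1r (max_idPr t'0).
apply: (Gbeta s (t', s^-1 *: x)); split=> /=; first by rewrite in_itv /= t'0.
move=> i; rewrite mxE in_itv /= -ler_norml normrM gtr0_norm ?invr_gt0 //.
by rewrite ler_pdivrMl ?mulr1 // (le_trans (enorm_coord x i)).
Unshelve. all: by end_near. Qed.

End Gains.

(** * Local estimates for the chained system *)

Section Chained.
Variables (R : realType) (k : R -> 'rV[R]_3 -> 'rV[R]_2).
Hypothesis kC1 : C1_halfspace k.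
Variable sigma : R -> R -> R.
Hypothesis k_stab : forall (t0 : R) (x0 : 'rV[R]_3), 0 <= t0 ->
  (exists x, chained_closed_loop k t0 x0 x) /\
  (forall x, chained_closed_loop k t0 x0 x ->
     forall t, t0 <= t -> enorm (x t) <= sigma (enorm x0) (t - t0)).
Implicit Types (y : R -> 'rV[R]_3) (a b t : R).

Lemma feedback_cvg y t : 0 < t -> {for t, continuous y} ->
  k s (y s) @[s --> t] --> k t (y t).
Proof.
move=> t0 yc.
have p : (s, y s) @[s --> t] --> (t, y t).
  by apply: (@cvg_pair _ _ _ _ (nbhs t) (nbhs (y t))) => //; exact: cvg_id.
have Kc := C1_halfspace_continuous kC1.
have := cvg_comp _ _ p (Kc (t, y t)).
rewrite /= (max_idPr (ltW t0)); apply: cvg_trans; apply: near_eq_cvg.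
near=> s; rewrite /= (max_idPr _) // ltW //.
by near: s; exact: lt_nbhsr.
Unshelve. all: by end_near. Qed.

(** The closed loop may be checked away from isolated times: its right-hand side
    is continuous along any continuous curve. *)
Lemma chained_removable y t : 0 < t -> {for t, continuous y} ->
  (\forall s \near t, s != t -> solves_at y s (chained_field (y s) (k s (y s)))) ->
  solves_at y t (chained_field (y t) (k t (y t))).
Proof.
move=> t0 yc ys j.
apply: (@is_derive_removable _ (fun s => y s ord0 j)
  (fun s => chained_field (y s) (k s (y s)) ord0 j)).
- exact: (@cvg_coord _ _ _ (nbhs t) _ y (y t) j yc).
- have kc i : k s (y s) 0 i @[s --> t] --> k t (y t) 0 i.
    exact: (@cvg_coord _ _ _ (nbhs t) _ _ _ i (feedback_cvg t0 yc)).
  have c0 : y s 0 0 @[s --> t] --> y t 0 0.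
    exact: (@cvg_coord _ _ _ (nbhs t) _ y (y t) 0 yc).
  suff : chained_field (y s) (k s (y s)) 0 j @[s --> t] -->
      chained_field (y t) (k t (y t)) 0 j by [].
  rewrite /chained_field.
  elim/ord3_ind: j; rewrite vec3E; under eq_fun do rewrite vec3E.
  + exact: kc.
  + exact: cvgM c0 (kc 1).
  + exact: kc.
- by apply: filterS ys => s /[apply]; apply.
Qed.

(** A solution that only exists on [a, t] is continued by a global one starting
    at its end point, to which the hypothesis on global solutions applies; the
    junction is a removable singularity. *)
Lemma chained_local_bound y a b t : 0 <= a ->
  {within `[a, b[, continuous y} ->
  (forall s, a < s < b -> solves_at y s (chained_field (y s) (k s (y s)))) ->
  a <= t < b -> enorm (y t) <= sigma (enorm (y a)) (t - a).
Proof.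
move=> a0 yc ys /andP[]; rewrite le_eqVlt => /orP[/eqP <- _|at_ tb].
  have [[x xs] xb] := k_stab (y a) a0.
  by have := xb x xs a (lexx _); have [-> _ _] := xs.
have t0 : 0 < t := le_lt_trans a0 at_.
have [[x [xt xc xs]] _] := k_stab (y t) (ltW t0).
pose g s := if s < t then y s else x s.
have gy s : s <= t -> g s = y s.
  by rewrite /g le_eqVlt => /orP[/eqP ->|->//]; rewrite ltxx.
have gx s : t <= s -> g s = x s by rewrite /g leNgt => /negbTE ->.
have gc : {within `[a, +oo[, continuous g}.
  have -> : `[a, +oo[%classic = `[a, t] `|` `[t, +oo[ :> set R.
    apply/seteqP; split => s /=; rewrite !in_itv /= !andbT.
      by move=> ?; case: (leP s t) => ?; [left|right; exact: ltW]; apply/andP.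
    by case=> [/andP[]//|]; apply: le_trans; exact: ltW.
  apply: withinU_continuous.
  - exact: interval_closed.
  - exact: interval_closed.
  - apply: (@subspace_eq_continuous _ _ _ y) => [s|].
      by rewrite inE /= in_itv /= => /andP[_ /gy].
    apply: continuous_subspaceW yc => s /=; rewrite !in_itv /= => /andP[-> h].
    exact: le_lt_trans h tb.
  - apply: (@subspace_eq_continuous _ _ _ x) => [s|//].
    by rewrite inE /= in_itv /= andbT => /gx.
have [_ /(_ g) gb] := k_stab (y a) a0.
rewrite -(gy t (lexx _)); apply: gb; last exact: ltW.
have gs s : a < s -> s != t -> solves_at g s (chained_field (g s) (k s (g s))).
  move=> as_ /lt_total/orP[st|ts].
    rewrite (gy _ (ltW st)); apply: solves_at_eq (ys s _).
      by near=> u; rewrite gy // ltW //; near: u; exact: lt_nbhsl.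
    by rewrite as_ (lt_trans st).
  rewrite (gx _ (ltW ts)); apply: solves_at_eq (xs s ts).
  by near=> u; rewrite gx // ltW //; near: u; exact: lt_nbhsr.
split=> // [|s as_]; first by rewrite gy // ltW.
have [->|st] := eqVneq s t; last exact: gs.
apply: chained_removable => //.
  by have /continuous_within_itvcyP[+ _] := gc; apply; rewrite in_itv /= at_.
by near=> u => ut; apply: gs => //; near: u; exact: lt_nbhsr.
Unshelve. all: by end_near. Qed.

End Chained.

(** * Behaviour of the delayed closed loop *)

Section Windows.
Variable R : realType.

Lemma within_coord n (A : set R) (X : R -> 'rV[R]_n) j :
  {within A, continuous X} -> {within A, continuous (fun s => X s 0 j)}.
Proof.
move=> cX x; apply: (@continuous_comp _ _ _ (from_subspace A X) (fun v : 'rV_n => v 0 j)).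
  exact: cX.
exact: coord_continuous.
Qed.

Lemma within_shift (V : topologicalType) (A B : set R) (X : R -> V) (c : R) :
  (forall s, B s -> A (s - c)) -> {within A, continuous X} ->
  {within B, continuous (fun s => X (s - c))}.
Proof.
move=> BA /subspace_continuousP cX; apply/subspace_continuousP => x Bx.
apply: cvg_comp (cX _ (BA _ Bx)) => P.
have : (s - c) @[s --> x] --> (x - c) by apply: cvgB; [exact: cvg_id|exact: cvg_cst].
move=> h /h; rewrite /within /=; apply: (@filterS _ (nbhs x)) => s /= hs Bs.
exact: hs (BA _ Bs).
Qed.

Lemma hnorm_le n (a : R) (phi : R -> 'rV[R]_n) (M : R) : 0 <= a ->
  (forall s, - a <= s <= 0 -> enorm (phi s) <= M) -> hnorm a phi <= M.
Proof.
move=> a0 h; apply: sup_le_ub; last by move=> _ [s /= hs <-]; exact: h.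
by exists (enorm (phi 0)), 0 => //=; rewrite in_itv /= lexx oppr_le0 a0.
Qed.

Lemma hnorm_ub n (a : R) (phi : R -> 'rV[R]_n) (M : R) s :
  (forall u, - a <= u <= 0 -> enorm (phi u) <= M) ->
  - a <= s <= 0 -> enorm (phi s) <= hnorm a phi.
Proof.
move=> h hs; apply: sup_upper_bound; last by exists s => //=; rewrite in_itv.
split; first by exists (enorm (phi s)), s => //=; rewrite in_itv.
by exists M => _ [u /= hu <-]; exact: h.
Qed.

Lemma space_C0_bounded n (a : R) (phi : R -> 'rV[R]_n) : space_C0 a phi ->
  exists M, forall u, - a <= u <= 0 -> enorm (phi u) <= M.
Proof.
move=> cphi; have H j : exists M, forall u, - a <= u <= 0 -> `|phi u 0 j| <= M.
  by have [_] := lbounded_continuous (within_coord (j := j) cphi).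
have [M HM] := choice H; exists (\sum_j M j) => u hu.
by rewrite (le_trans (enorm_le_sum _)) // ler_sum // => j _; exact: HM.
Qed.

Lemma vehicle_field_le (q : 'rV[R]_3) (u : 'rV[R]_2) j :
  `|vehicle_field q u 0 j| <= enorm u.
Proof.
have cs (a c : R) : `|c| <= 1 -> `|a * c| <= `|a|.
  by move=> c1; rewrite normrM ler_piMr.
rewrite /vehicle_field; elim/ord3_ind: j; rewrite vec3E.
- rewrite (le_trans (cs _ _ _)) ?enorm_coord // ler_norml.
  by rewrite cos_geN1 cos_le1.
- rewrite (le_trans (cs _ _ _)) ?enorm_coord // ler_norml.
  by rewrite sin_geN1 sin_le1.
- exact: enorm_coord.
Qed.

Section Sampling.
Variables (t0 T : R).
Hypothesis T0 : 0 < T.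
Notation S := (sampling_time t0 T).

Lemma sampling0 : S 0 = t0. Proof. by rewrite /sampling_time mul0r addr0. Qed.

Lemma samplingS i : S i.+1 = S i + T.
Proof. by rewrite /sampling_time -natr1; ring. Qed.

Lemma sampling_ge i : t0 <= S i.
Proof. by rewrite /sampling_time lerDl mulr_ge0 // ltW. Qed.

Lemma sampling_le i j : (i <= j)%N -> S i <= S j.
Proof. by move=> ij; rewrite /sampling_time lerD2l ler_pM2r // ler_nat. Qed.

Lemma sampling_lt i : S i < S i.+1.
Proof. by rewrite samplingS ltrDl. Qed.

Lemma sampling_interval t : t0 <= t -> exists i, S i <= t < S i.+1.
Proof.
move=> t0t; have := truncn_itv (divr_ge0 (_ : 0 <= t - t0) (ltW T0)).
rewrite subr_ge0 => /(_ t0t); rewrite ler_pdivlMr // ltr_pdivrMr // => /andP[h1 h2].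
by exists (Num.trunc ((t - t0) / T)); rewrite /sampling_time -lerBrDl h1 -ltrBlDl.
Qed.

End Sampling.

Lemma heading_lbounded (a b th : R) (f c : R -> R) : continuous c ->
  (forall b', lbounded a b' f) -> lbounded a b (fun s => c (th + lint a s f)).
Proof.
move=> cc bf.
apply: (@lbounded_eq _ _ _ (fun s => c (th + lint a (Num.max a s) f))).
  by move=> s /andP[/max_idPr ->].
apply: lbounded_continuous; apply: continuous_subspaceT => s.
apply: (@continuous_comp _ _ _ (fun s => th + lint a (Num.max a s) f) c); last exact: cc.
by apply: cvgD; [exact: cvg_cst|exact: lint_clamp_continuous].
Qed.

(** The heading is the integral of the angular velocity, so the predicted motion
    is the integral of the vehicle field along that heading; only the third
    coordinate of the argument of the field matters, whence the zeros. *)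
Lemma heading_field_lbounded (a b th : R) (U : R -> 'rV[R]_2) j :
  (forall b' i, lbounded a b' (fun s => U s 0 i)) ->
  lbounded a b (fun s =>
    vehicle_field (vec3 0 0 (th + lint a s (fun p => U p 0 1))) (U s) 0 j).
Proof.
move=> bU; have bh c : continuous c ->
    lbounded a b (fun s => c (th + lint a s (fun p => U p 0 1))).
  by move=> cc; exact: heading_lbounded.
rewrite /vehicle_field; elim/ord3_ind: j.
- apply: (@lbounded_eq _ _ _
    (fun s => U s 0 0 * cos (th + lint a s (fun p => U p 0 1)))).
    by move=> s _; rewrite !vec3E.
  by apply: lbounded_mul => //; apply: bh; exact: continuous_cos.
- apply: (@lbounded_eq _ _ _
    (fun s => U s 0 0 * sin (th + lint a s (fun p => U p 0 1)))).
    by move=> s _; rewrite !vec3E.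
  by apply: lbounded_mul => //; apply: bh; exact: continuous_sin.
- by apply: lbounded_eq (bU b 1) => s _; rewrite !vec3E.
Qed.

Lemma predictorE (a b : R) (q : 'rV[R]_3) (U : R -> 'rV[R]_2) j :
  predictor a b q U 0 j = q 0 j + lint a b (fun s =>
    vehicle_field (vec3 0 0 (q 0 2 + lint a s (fun p => U p 0 1))) (U s) 0 j).
Proof.
by rewrite /predictor /vehicle_field; elim/ord3_ind: j; rewrite vec3E;
  congr (_ + _); apply: lint_eq => s _; rewrite !vec3E.
Qed.

Lemma predictor_bound (a b e : R) (q : 'rV[R]_3) (U : R -> 'rV[R]_2) j : a <= b ->
  (forall b' i, lbounded a b' (fun s => U s 0 i)) ->
  (forall s, a < s < b -> enorm (U s) <= e) ->
  `|predictor a b q U 0 j| <= `|q 0 j| + e * (b - a).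
Proof.
move=> ab bU Ue; rewrite predictorE (le_trans (ler_normD _ _)) // lerD2l.
apply: lint_bound => //; first exact: heading_field_lbounded.
by move=> s hs; rewrite (le_trans (vehicle_field_le _ _ _)) // Ue.
Qed.

End Windows.

Section Solution.
Variables (R : realType) (k : R -> 'rV[R]_3 -> 'rV[R]_2) (r tau T : R).
Hypotheses (r0 : 0 <= r) (tau0 : 0 <= tau) (T0 : 0 < T).
Hypothesis kC1 : C1_halfspace k.
Variables (t0 : R) (X0 : R -> 'rV[R]_3) (z0 : 'rV[R]_3) (U0 : R -> 'rV[R]_2).
Variables (X z : R -> 'rV[R]_3) (U : R -> 'rV[R]_2).
Hypothesis t0_ge0 : 0 <= t0.
Hypothesis sol : delayed_closed_loop k r tau T t0 X0 z0 U0 X z U.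
Notation S := (sampling_time t0 T).

Lemma input_lbounded a b j : t0 - r - tau <= a -> lbounded a b (fun s => U s 0 j).
Proof.
move=> ha; pose t := Num.max t0 b.
have t0t : t0 <= t by rewrite le_max lexx.
apply: (@lbounded_sub _ (t0 - r - tau) t) => //; first by rewrite le_max lexx orbT.
have [mU [M UM]] := dcl_U_Linf sol t0t.
have h : lbounded (- (t - t0 + r + tau)) 0 (fun s => hist t U s 0 j).
  split; first exact: mU.
  exists M => s hs; apply: le_trans (enorm_coord _ _) (UM s _).
  by rewrite in_itv.
have := lbounded_shift t h; rewrite add0r.
rewrite (_ : - (t - t0 + r + tau) + t = t0 - r - tau); last by ring.
by apply: lbounded_eq => s _; rewrite /hist addrC subrK.
Qed.

Lemma field_lbounded a b j : t0 - tau <= a ->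
  lbounded a b (fun s => vehicle_field (X (s + tau)) (U s) 0 j).
Proof.
move=> ha; have bU i : lbounded a b (fun s => U s 0 i).
  by apply: input_lbounded; rewrite (le_trans _ ha) // lerD2r gerBl.
have bX c : continuous c -> lbounded a b (fun s => c (X (s + tau) 0 2)).
  move=> cc; suff /(lbounded_shift (- tau)) : lbounded (a + tau) (b + tau)
      (fun s => c (X s 0 2)).
    by rewrite !addrK; apply: lbounded_eq => s _; rewrite opprK.
  apply: lbounded_continuous.
  have : {within `[a + tau, b + tau], continuous (fun s => X s 0 2)}.
    apply: within_coord; apply: continuous_subspaceW (dcl_X_cont sol) => s /=.
    rewrite !in_itv /= andbT => /andP[h _]; apply: le_trans h; have := r0; lra.
  by move=> cX x; apply: (continuous_comp (cX x)); exact: cc.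
rewrite /vehicle_field; elim/ord3_ind: j.
- apply: (@lbounded_eq _ _ _ (fun s => U s 0 0 * cos (X (s + tau) 0 2))).
    by move=> s _; rewrite !vec3E.
  by apply: lbounded_mul => //; apply: bX; exact: continuous_cos.
- apply: (@lbounded_eq _ _ _ (fun s => U s 0 0 * sin (X (s + tau) 0 2))).
    by move=> s _; rewrite !vec3E.
  by apply: lbounded_mul => //; apply: bX; exact: continuous_sin.
- by apply: lbounded_eq (bU 1) => s _; rewrite !vec3E.
Qed.

(** In the time of the controller the delay disappears: the vehicle seen [tau]
    ahead is driven by the current input. *)
Lemma plant_shift a b j : t0 <= a + tau -> a <= b ->
  X (b + tau) 0 j = X (a + tau) 0 j +
  lint a b (fun s => vehicle_field (X (s + tau)) (U s) 0 j).
Proof.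
move=> ha ab; rewrite -(lint_shift tau); last by apply: field_lbounded; lra.
have E p q : lint p q (fun s => vehicle_field (X (s - tau + tau)) (U (s - tau)) 0 j) =
    lint p q (fun s => vehicle_field (X s) (U (s - tau)) ord0 j).
  by apply: lint_eq => s _; rewrite subrK.
have hab : a + tau <= b + tau by rewrite lerD2r.
rewrite (dcl_plant sol j ha) (dcl_plant sol j (le_trans ha hab)) -!E -addrA.
rewrite -lint_split //; have := @field_lbounded (t0 - tau) b j (lexx _).
by move/(lbounded_shift tau); rewrite subrK.
Qed.

Lemma state_bound a b e j : t0 <= a + tau -> a <= b ->
  (forall s, a < s < b -> enorm (U s) <= e) ->
  `|X (b + tau) 0 j| <= `|X (a + tau) 0 j| + e * (b - a).
Proof.
move=> ha ab Ue; rewrite (plant_shift j ha ab) (le_trans (ler_normD _ _)) // lerD2l.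
apply: lint_bound => //; first by apply: field_lbounded; lra.
by move=> s hs; rewrite (le_trans (vehicle_field_le _ _ _)) // Ue.
Qed.

(** Once the measured state [X (b - r)] obeys the plant equation, integrating
    the stored inputs from it reproduces the state [tau] ahead of [b]. *)
Lemma predictor_exact b : t0 <= b - r ->
  predictor (b - r - tau) b (X (b - r)) U = X (b + tau).
Proof.
move=> hb; set a := b - r - tau.
have aE : a + tau = b - r by rewrite /a subrK.
have ha : t0 <= a + tau by rewrite aE.
have ab : a <= b by have := r0; have := tau0; rewrite /a; lra.
have hdE s : a <= s -> X (b - r) 0 2 + lint a s (fun p => U p 0 1) = X (s + tau) 0 2.
  move=> as_; rewrite (plant_shift 2 ha as_) aE; congr (_ + _).
  by apply: lint_eq => p _; rewrite /vehicle_field vec3E.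
apply/rowP; elim/ord3_ind; rewrite /predictor vec3E; last exact: hdE.
- rewrite (plant_shift 0 ha ab) aE; congr (_ + _).
  by apply: lint_eq => p /andP[hp _]; rewrite /vehicle_field vec3E hdE.
- rewrite (plant_shift 1 ha ab) aE; congr (_ + _).
  by apply: lint_eq => p /andP[hp _]; rewrite /vehicle_field vec3E hdE.
Qed.

Lemma observer_chained i t : S i < t < S i.+1 ->
  solves_at (fun s => zeta (z (s - tau))) (t + tau)
    (chained_field (zeta (z t)) (k (t + tau) (zeta (z t)))).
Proof.
move=> /andP[h1 h2]; have t0t : t0 < t := le_lt_trans (sampling_ge t0 T0 i) h1.
apply: (@solves_at_shift _ _ (fun s => zeta (z s))).
apply: (zeta_vehicle (u := U t)) (dcl_z_flow sol h1 h2).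
- exact (dcl_omega sol t0t).
- exact (dcl_v sol t0t).
Qed.

Lemma observer_continuous i t : S i < t < S i.+1 -> {for t, continuous z}.
Proof.
move=> /andP[h1 h2].
have h : {within `[S i, (t + S i.+1) / 2], continuous z}.
  apply: continuous_subspaceW (dcl_z_cont sol (i := i)) => s /=.
  by rewrite !in_itv /= => /andP[-> h] /=; lra.
by apply: within_continuous_continuous h _; rewrite ?in_itv /=; lra.
Qed.

(** Away from the sampling times the input is a continuous function of the
    observer, hence the fundamental theorem of calculus applies to the plant. *)
Lemma input_continuous i t j : S i < t < S i.+1 ->
  {for t, continuous (fun s => U s 0 j)}.
Proof.
move=> hi; have zc := observer_continuous hi; have /andP[h1 h2] := hi.
have t0t : t0 < t := le_lt_trans (sampling_ge t0 T0 i) h1.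
have zzc : {for t, continuous (fun s => zeta (z s))}.
  by apply: (continuous_comp zc); exact: zeta_continuous.
have kc i' : k (s + tau) (zeta (z s)) 0 i' @[s --> t] --> k (t + tau) (zeta (z t)) 0 i'.
  have yc : {for t + tau, continuous (fun s => zeta (z (s - tau)))}.
    have h : (s - tau) @[s --> t + tau] --> t.
      rewrite -[X in _ --> X](addrK tau).
      by apply: cvgB; [exact: cvg_id|exact: cvg_cst].
    suff : zeta (z (s - tau)) @[s --> t + tau] --> zeta (z (t + tau - tau)) by [].
    by rewrite addrK; exact: (cvg_comp _ _ h zzc).
  have tt : 0 < t + tau by have := t0_ge0; have := tau0; lra.
  have h : (s + tau) @[s --> t] --> t + tau.
    by apply: cvgD; [exact: cvg_id|exact: cvg_cst].
  have := cvg_comp _ _ h (feedback_cvg kC1 tt yc); rewrite addrK /comp.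
  under eq_fun do rewrite addrK.
  exact: (@cvg_coord _ _ _ (nbhs t) _ _ _ i').
have zj i' : zeta (z s) 0 i' @[s --> t] --> zeta (z t) 0 i'.
  exact: (@cvg_coord _ _ _ (nbhs t) _ _ _ i' zzc).
have t0s : \forall s \near t, t0 < s by exact: lt_nbhsr.
have E1 s : t0 < s -> U s 0 1 = k (s + tau) (zeta (z s)) 0 1.
  exact (dcl_omega sol (t:=s)).
have E0 s : t0 < s -> U s 0 0 = k (s + tau) (zeta (z s)) 0 0 +
    zeta (z s) 0 1 * k (s + tau) (zeta (z s)) 0 1.
  by move=> ts; rewrite (dcl_v sol ts) E1 // vec3E.
suff : U s 0 j @[s --> t] --> U t 0 j by [].
elim/ord2_ind: j.
- rewrite (E0 _ t0t); apply: cvg_trans (cvgD (kc 0) (cvgM (zj 1) (kc 1))).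
  by apply: near_eq_cvg; apply: filterS t0s => s ts; rewrite /= E0.
- rewrite (E1 _ t0t); apply: cvg_trans (kc 1).
  by apply: near_eq_cvg; apply: filterS t0s => s ts; rewrite /= E1.
Qed.

(** From the first sampling time whose measurement is a state of the plant, the
    observer runs exactly [tau] ahead of the vehicle: both start from the same
    point at each sampling time and are driven by the same input. *)
Lemma observer_exact i t : t0 <= S i.+1 - r -> S i.+1 <= t < S i.+2 ->
  z t = X (t + tau).
Proof.
set a := S i.+1 => hr /andP[at_ tb].
have za : z a = X (a + tau) by rewrite (dcl_z_reset sol i) predictor_exact.
have ha s : a <= s -> t0 <= s + tau.
  by move=> as_; have := sampling_ge t0 T0 i.+1; have := tau0; rewrite -/a; lra.
have cz : {within `[a, t], continuous z}.
  apply: continuous_subspaceW (dcl_z_cont sol (i := i.+1)) => s /=.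
  by rewrite !in_itv /= => /andP[-> h] /=; lra.
have cX : {within `[a, t], continuous (fun s => X (s + tau))}.
  have := @within_shift _ _ (`[t0 - r, +oo[)%classic `[a, t]%classic X (- tau).
  rewrite opprK; apply; last exact: dcl_X_cont sol.
  move=> s /=; rewrite !in_itv /= andbT => /andP[/ha h _]; have := r0; lra.
have hs s : a < s < t -> S i.+1 < s < S i.+2.
  by move=> /andP[-> h] /=; exact: lt_trans h tb.
have dz s j : a < s < t ->
    is_derive s (1 : R) (fun s => z s 0 j) (vehicle_field (z s) (U s) 0 j).
  by move=> /hs/andP[h1 h2]; exact: (dcl_z_flow sol h1 h2 j).
have dX s j : a < s < t -> {for s, continuous (fun s => vehicle_field (X (s + tau)) (U s) 0 j)} ->
    is_derive s (1 : R) (fun s => X (s + tau) 0 j) (vehicle_field (X (s + tau)) (U s) 0 j).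
  move=> /andP[h1 h2] fc.
  apply: (@near_eq_is_derive _ _ _ (fun u => X (a + tau) 0 j +
      lint a u (fun s => vehicle_field (X (s + tau)) (U s) 0 j))).
    near=> u; rewrite [RHS](plant_shift j (ha _ (lexx a))) //.
    by apply: ltW; near: u; exact: lt_nbhsr.
  have ss1 : s < s + 1 by rewrite ltrDl.
  have ta : t0 - tau <= a by have := ha _ (lexx a); lra.
  have d := is_derive_lint h1 ss1 (field_lbounded (s + 1) j ta) fc.
  apply: (is_derive_eq (is_deriveD (is_derive_cst (X (a + tau) 0 j) s 1) d)).
  exact: add0r.
have uc s j : a < s < t -> {for s, continuous (fun s => U s 0 j)}.
  by move=> /hs; exact: input_continuous.
have cc s (c : R -> R) : a < s < t -> continuous c ->
    {for s, continuous (fun s => c (X (s + tau) 0 2))}.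
  move=> hst cc; have at' : a < t by case/andP: hst; exact: lt_trans.
  have Xs : {for s, continuous (fun s => X (s + tau) 0 2)}.
    by apply: within_continuous_continuous at' (within_coord cX) _; rewrite in_itv.
  by apply: (continuous_comp Xs); exact: cc.
have fcont s j : a < s < t ->
    {for s, continuous (fun s => vehicle_field (X (s + tau)) (U s) 0 j)}.
  move=> hst; have ext (f g : R -> R) :
      f =1 g -> {for s, continuous f} -> {for s, continuous g} by move=> /funext ->.
  rewrite /vehicle_field; elim/ord3_ind: j.
  - apply: (ext (fun s => U s 0 0 * cos (X (s + tau) 0 2))); first by move=> u; rewrite vec3E.
    exact: cvgM (uc s 0 hst) (cc s cos hst (@continuous_cos R)).
  - apply: (ext (fun s => U s 0 0 * sin (X (s + tau) 0 2))); first by move=> u; rewrite vec3E.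
    exact: cvgM (uc s 0 hst) (cc s sin hst (@continuous_sin R)).
  - by apply: ext (uc s 1 hst) => u; rewrite vec3E.
(* the headings first: they determine the right-hand side of the others *)
have z2 s : a <= s <= t -> z s 0 2 = X (s + tau) 0 2.
  move=> /andP[as_ st].
  have sub u : a < u < s -> a < u < t by move=> /andP[-> h] /=; exact: lt_le_trans h st.
  have sub' : `[a, s]%classic `<=` `[a, t].
    by apply: subset_itv; rewrite bnd_simp.
  apply: (@eq_derive_eq _ (fun s => z s 0 2) (fun s => X (s + tau) 0 2)
    (fun s => U s 0 1) a s as_).
  - exact: continuous_subspaceW sub' (within_coord cz).
  - exact: continuous_subspaceW sub' (within_coord cX).
  - by move=> u /sub hu; have := dz u 2 hu; rewrite /vehicle_field vec3E.
  - move=> u /sub hu; have := dX u 2 hu (fcont u 2 hu); rewrite /vehicle_field vec3E; apply.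
  - by rewrite za.
have fE s j : a < s < t ->
    vehicle_field (z s) (U s) 0 j = vehicle_field (X (s + tau)) (U s) 0 j.
  move=> /andP[h1 h2]; rewrite /vehicle_field -z2 ?(ltW h1) ?(ltW h2) //.
apply/rowP => j; apply: (@eq_derive_eq _ (fun s => z s 0 j)
  (fun s => X (s + tau) 0 j) (fun s => vehicle_field (z s) (U s) 0 j) a t at_).
- exact: within_coord.
- exact: within_coord.
- by move=> s hst; rewrite fE //; apply: dX => //; exact: fcont.
- by rewrite za.
Unshelve. all: by end_near. Qed.

End Solution.

(** * The stability estimate *)

Section Estimate.
Variables (R : realType) (k : R -> 'rV[R]_3 -> 'rV[R]_2) (r tau T : R).
Hypotheses (r0 : 0 <= r) (tau0 : 0 <= tau) (T0 : 0 < T).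
Hypothesis kC1 : C1_halfspace k.
Variables (sigma : R -> R -> R) (beta : R -> R).
Hypothesis sigmaKL : class_KL sigma.
Hypothesis k_stab : forall (t0 : R) (x0 : 'rV[R]_3), 0 <= t0 ->
  (exists x, chained_closed_loop k t0 x0 x) /\
  (forall x, chained_closed_loop k t0 x0 x ->
     forall t, t0 <= t -> enorm (x t) <= sigma (enorm x0) (t - t0)).
Hypothesis beta_gain : gain beta.
Hypothesis k_beta : forall t x s j, 0 <= t -> enorm x <= s -> `|k t x 0 j| <= beta s.

(** The forward speed is the first feedback plus the lateral drift, of size at
    most [s], times the second feedback; the factor 2 bounds the Euclidean norm
    of a planar vector by that of its coordinates. *)
Definition input_gain (s : R) : R := 2%:R * (beta s + pos s * beta s).

Lemma input_gain_gain : gain input_gain.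
Proof.
apply: gainZ => //; apply: gainD => //; apply: gainM => //; exact: gain_pos.
Qed.

Section Solution.
Variables (t0 : R) (X0 : R -> 'rV[R]_3) (z0 : 'rV[R]_3) (U0 : R -> 'rV[R]_2).
Variables (X z : R -> 'rV[R]_3) (U : R -> 'rV[R]_2).
Hypothesis t0_ge0 : 0 <= t0.
Hypothesis sol : delayed_closed_loop k r tau T t0 X0 z0 U0 X z U.
Notation S := (sampling_time t0 T).

Lemma input_bound t e : t0 < t -> enorm (z t) <= e -> enorm (U t) <= input_gain e.
Proof.
move=> t0t ze; have zze : enorm (zeta (z t)) <= e by rewrite enorm_zeta.
have tt : 0 <= t + tau by have := t0_ge0; have := tau0; lra.
have e0 : 0 <= e := le_trans (enorm_ge0 _) ze.
have b0 := gain_ge0 e beta_gain.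
have kb j := k_beta j tt zze.
have U1 : `|U t 0 1| <= beta e by rewrite (dcl_omega sol t0t) kb.
apply: enorm_le_coord; elim/ord2_ind.
  rewrite (dcl_v sol t0t) (le_trans (ler_normD _ _)) // lerD ?kb //.
  rewrite normrM ler_pM // pos_id //.
  by have := le_trans (enorm_coord (zeta (z t)) 1) zze; rewrite /zeta vec3E.
by rewrite (le_trans U1) // lerDl mulr_ge0 // pos_ge0.
Qed.

(** Between sampling times [zeta (z (s - tau))] solves the chained closed loop
    with the feedback evaluated at its own time, and [zeta] preserves norms. *)
Lemma observer_interval_bound i t : S i <= t < S i.+1 ->
  enorm (z t) <= sigma (enorm (z (S i))) (t - S i).
Proof.
move=> /andP[h1 h2].
have := chained_local_bound kC1 k_stab (y := fun s => zeta (z (s - tau)))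
  (a := S i + tau) (b := S i.+1 + tau) (t := t + tau).
rewrite !addrK !enorm_zeta (_ : t + tau - (S i + tau) = t - S i); last by ring.
apply.
- by have := sampling_ge t0 T0 i; have := t0_ge0; have := tau0; lra.
- have h : {within `[S i, S i.+1[, continuous (fun s => zeta (z s))}.
    move=> x; apply: (@continuous_comp _ _ _ (from_subspace _ z) (@zeta R)).
      exact: (dcl_z_cont sol (i := i)).
    exact: zeta_continuous.
  apply: (within_shift (X := fun s => zeta (z s))) h => s /=.
  by rewrite !in_itv /= lerBrDr ltrBlDr.
- move=> s /andP[s1 s2].
  have := observer_chained T0 sol (i := i) (t := s - tau); rewrite subrK; apply.
  by rewrite ltrBrDr s1 ltrBlDr.
- by rewrite lerD2r h1 ltrD2r.
Qed.

Lemma observer_exact_after N t : t0 <= S N.+1 - r -> S N.+1 <= t -> z t = X (t + tau).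
Proof.
move=> hN Nt.
have [[|i] /andP[h1 h2]] := sampling_interval T0 (le_trans (sampling_ge t0 T0 N.+1) Nt).
  have := lt_le_trans h2 (le_trans (sampling_le t0 T0 (_ : 1 <= N.+1)%N) Nt).
  by rewrite ltxx => /(_ isT).
apply: (observer_exact r0 tau0 T0 kC1 t0_ge0 sol (i := i)); last by rewrite h1.
rewrite (le_trans hN) // lerD2r; apply: sampling_le => //.
rewrite leqNgt; apply/negP => iN.
have := lt_le_trans h2 (le_trans (sampling_le t0 T0 iN) Nt).
by rewrite ltxx.
Qed.

(** After the transient the observer is a single solution of the chained system:
    it has no jumps since it coincides with the shifted vehicle. *)
Lemma observer_tail_bound N t : t0 <= S N.+1 - r -> S N.+1 <= t ->
  enorm (z t) <= sigma (enorm (z (S N.+1))) (t - S N.+1).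
Proof.
move=> hN Nt; set a := S N.+1 in hN Nt *.
pose y s := zeta (z (s - tau)).
have at0 : t0 < a.
  have := sampling_lt t0 T0 0; rewrite sampling0 => h; apply: lt_le_trans h _.
  exact: sampling_le.
have a0 : 0 <= a + tau by have := t0_ge0; have := tau0; lra.
have yX s : a + tau <= s -> y s = zeta (X s).
  move=> as_; rewrite /y (observer_exact_after hN) ?subrK //; by rewrite lerBrDr.
have yc : {within `[a + tau, +oo[, continuous y}.
  apply: (@subspace_eq_continuous _ _ _ (fun s => zeta (X s))) => [s|].
    by rewrite inE /= in_itv /= andbT => /yX.
  have h : {within `[a + tau, +oo[, continuous X}.
    apply: continuous_subspaceW (dcl_X_cont sol) => s /=; rewrite !in_itv /= !andbT.
    by have := r0; have := tau0; lra.
  move=> x; apply: (@continuous_comp _ _ _ (from_subspace _ X) (@zeta R)).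
    exact: h.
  exact: zeta_continuous.
have ys i s : S i + tau < s < S i.+1 + tau -> solves_at y s (chained_field (y s) (k s (y s))).
  move=> /andP[h1 h2].
  have := observer_chained T0 sol (i := i) (t := s - tau); rewrite subrK; apply.
  by rewrite ltrBrDr h1 ltrBlDr.
have ysol : chained_closed_loop k (a + tau) (y (a + tau)) y.
  split=> // s as_; have h0 : t0 <= s - tau by move: as_ at0; lra.
  have [i /andP[]] := sampling_interval T0 h0.
  rewrite lerBrDr ltrBlDr le_eqVlt => /orP[/eqP is_ si|h1 h2]; last first.
    by apply: (ys i); rewrite h1.
  case: i is_ si => [|i] is_ si.
    by move: is_ as_ at0; rewrite sampling0; lra.
  (* s - tau is a sampling time *)
  apply: chained_removable => //; first exact: le_lt_trans a0 as_.
    by have /continuous_within_itvcyP[+ _] := yc; apply; rewrite in_itv /= as_.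
  have h1 : S i + tau < s by rewrite -is_ ltrD2r sampling_lt.
  near=> u => us; have [us'|su] := ltP u s.
    apply: (ys i); rewrite is_ us' andbT; near: u; exact: lt_nbhsr.
  apply: (ys i.+1); rewrite is_ lt_neqAle eq_sym us su /=.
  near: u; exact: lt_nbhsl.
have [_ /(_ y ysol (t + tau))] := k_stab (y (a + tau)) a0.
rewrite /y !addrK !enorm_zeta (_ : t + tau - (a + tau) = t - a); last by ring.
by apply; rewrite lerD2r.
Unshelve. all: by end_near. Qed.

End Solution.

Definition bounded_upto (t0 : R) (X z : R -> 'rV[R]_3) (U : R -> 'rV[R]_2)
    (i : nat) (B : R) :=
  [/\ forall t, t0 <= t <= sampling_time t0 T i -> enorm (z t) <= B,
      forall t, t0 - r <= t <= sampling_time t0 T i -> enorm (X t) <= B &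
      forall t, t0 - r - tau <= t <= sampling_time t0 T i -> enorm (U t) <= B].

(** Over one sampling period the observer obeys the chained estimate, hence the
    inputs, then the vehicle and finally the value to which the observer is
    reset stay bounded by gains of the previous bound.  The input at the next
    sampling time depends on the reset, so it is bounded last; the integrals
    that enter the reset ignore it. *)
Lemma bounded_step i : exists2 G, gain G &
  forall (t0 : R) X0 z0 U0 X z U B, 0 <= t0 ->
    delayed_closed_loop k r tau T t0 X0 z0 U0 X z U ->
    bounded_upto t0 X z U i B -> bounded_upto t0 X z U i.+1 (G B).
Proof.
pose al s := sigma (pos s) 0.
have al_gain : gain al by exact: gain_KL0.
have ig := input_gain_gain.
(* e2 bounds the inputs before the next sampling time, e3 the vehicle up to it,
   e4 the observer after the reset; 3 is the number of coordinates *)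
pose e2 s := pos s + input_gain (al s).
have e2_gain : gain e2 by apply: gainD; [exact: gain_pos|exact: gain_comp].
pose e3 s := 3%:R * (pos s + i.+1%:R * T * e2 s).
have e3_gain : gain e3.
  apply: gainZ => //; apply: gainD; first exact: gain_pos.
  by apply: gainZ => //; rewrite mulr_ge0 // ltW.
pose e4 s := 3%:R * (e3 s + (r + tau) * e2 s).
have e4_gain : gain e4.
  by apply: gainZ => //; apply: gainD => //; apply: gainZ => //; rewrite addr_ge0.
pose G s := pos s + al s + input_gain (al s) + e3 s + e4 s + input_gain (e4 s).
have G_gain : gain G.
  have g1 := gain_comp ig al_gain; have g2 := gain_comp ig e4_gain.
  have gp := gainD (gain_pos R) al_gain.
  exact: gainD (gainD (gainD (gainD gp g1) e3_gain) e4_gain) g2.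
exists G => // t0 X0 z0 U0 X z U B t0_ge0 sol [zB XB UB].
set S := sampling_time t0 T in zB XB UB *.
have St := sampling_ge t0 T0 i; have lt_S := sampling_lt t0 T0 i.
rewrite -/S in St lt_S.
have B0 : 0 <= B by rewrite (le_trans (enorm_ge0 (z (S i)))) // zB // St lexx.
have posB : pos B = B by rewrite pos_id.
have [n1 n2 n3] : [/\ 0 <= al B, 0 <= input_gain (al B) & 0 <= e3 B].
  by split; exact: gain_ge0.
have [n4 n5] : 0 <= e4 B /\ 0 <= input_gain (e4 B) by split; exact: gain_ge0.
have zal t : S i <= t < S i.+1 -> enorm (z t) <= al B.
  move=> ht; rewrite (le_trans (observer_interval_bound t0_ge0 sol ht)) //.
  have [_ _ _ sm _] := sigmaKL; have /andP[h _] := ht.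
  apply: (@le_trans _ _ (sigma (enorm (z (S i))) 0)).
    by apply: sm; rewrite ?enorm_ge0 ?lexx ?subr_ge0.
  by rewrite /al KL_le // ?enorm_ge0 // posB zB // St lexx.
have Ue2 t : t0 - r - tau <= t < S i.+1 -> enorm (U t) <= e2 B.
  move=> /andP[h1 h2]; rewrite /e2 posB; have [ti|it] := leP t (S i).
    by rewrite (le_trans (UB t _)) ?h1 // lerDl.
  rewrite (le_trans (input_bound t0_ge0 sol (e := al B) _ _)) ?lerDr //.
    exact: le_lt_trans St it.
  by apply: zal; rewrite (ltW it).
have rt := r0; have tt := tau0.
have Xe3 t : t0 - r <= t <= S i.+1 -> enorm (X t) <= e3 B.
  move=> /andP[h1 h2]; apply: enorm_le_coord => j; rewrite posB.
  have [tt0|t0t] := leP t t0.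
    apply: (@le_trans _ _ B); last first.
      by rewrite lerDl; do !apply: mulr_ge0 => //; [exact: ltW|exact: gain_ge0].
    by rewrite (le_trans (enorm_coord _ _)) // XB // h1 (le_trans tt0).
  have := state_bound r0 sol (a := t0 - tau) (b := t - tau) (e := e2 B) j.
  (* integrate from t0: the delayed input only involves times before S i.+1 *)
  rewrite !subrK => h; apply: (le_trans (h _ _ _)) => //; first by lra.
    by move=> s /andP[s1 s2]; apply: Ue2; apply/andP; split; lra.
  apply: lerD.
    rewrite (le_trans (enorm_coord _ _)) // XB // St andbT; lra.
  rewrite mulrC ler_wpM2r ?gain_ge0 //.
  by move: h2; rewrite /S /sampling_time; lra.
have ze4 : enorm (z (S i.+1)) <= e4 B.
  apply: enorm_le_coord => j; rewrite (dcl_z_reset sol i) -/S.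
  have h1 : S i.+1 - r - tau <= S i.+1 by lra.
  have h2 b' i' : lbounded (S i.+1 - r - tau) b' (fun s => U s 0 i').
    by apply: (input_lbounded sol); lra.
  apply: (le_trans (predictor_bound (X (S i.+1 - r)) j h1 h2 (e := e2 B) _)).
    by move=> s /andP[s1 s2]; apply: Ue2; apply/andP; split; lra.
  rewrite (_ : S i.+1 - (S i.+1 - r - tau) = r + tau); last by ring.
  rewrite [e2 B * _]mulrC lerD2r (le_trans (enorm_coord _ _)) // Xe3 //.
  by apply/andP; split; lra.
have zG t : t0 <= t <= S i.+1 ->
    enorm (z t) <= B \/ enorm (z t) <= al B \/ t = S i.+1.
  move=> /andP[h1]; rewrite le_eqVlt => /orP[/eqP ->|h2]; first by right; right.
  have [ti|it] := leP t (S i); first by left; rewrite zB // h1.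
  by right; left; rewrite zal // h2 ltW.
have pG : pos B + al B + input_gain (al B) + e3 B + e4 B + input_gain (e4 B) = G B by [].
split=> t ht; rewrite -pG posB.
- case: (zG t ht) => [h|[h|->]]; [lra|lra|].
  by move: ze4; lra.
- by have := Xe3 t ht; lra.
- have /andP[h1 h2] := ht; move: h2; rewrite le_eqVlt => /orP[/eqP tE|h2].
    have := input_bound t0_ge0 sol (le_lt_trans St lt_S) ze4; rewrite /S -tE; lra.
  by have := Ue2 t; rewrite h1 h2 /e2 posB => /(_ isT); lra.
Qed.

(** The gain depends on the number of periods but neither on the initial time
    nor on the initial data. *)
Lemma bounded_transient i : exists2 F, gain F &
  forall (t0 : R) X0 z0 U0 X z U, 0 <= t0 -> space_C0 r X0 -> space_Linf (r + tau) U0 ->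
    delayed_closed_loop k r tau T t0 X0 z0 U0 X z U ->
    bounded_upto t0 X z U i (F (enorm z0 + hnorm r X0 + hnorm (r + tau) U0)).
Proof.
elim: i => [|i [F Fg FB]]; last first.
  have [G Gg GB] := bounded_step i; exists (fun s => G (F s)); first exact: gain_comp.
  by move=> t0 X0 z0 U0 X z U h1 h2 h3 sol; exact: GB h1 sol (FB _ _ _ _ _ _ _ h1 h2 h3 sol).
exists (@pos R); first exact: gain_pos.
move=> t0 X0 z0 U0 X z U h1 /space_C0_bounded[M XM] [_ [M' UM]] sol.
have rt := r0; have tt := tau0.
have Xh s : - r <= s <= 0 -> enorm (X0 s) <= hnorm r X0 by exact: hnorm_ub XM.
have Uh s : - (r + tau) <= s <= 0 -> enorm (U0 s) <= hnorm (r + tau) U0.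
  by apply: hnorm_ub => u hu; apply: UM; rewrite in_itv.
have pX : 0 <= hnorm r X0.
  by rewrite (le_trans (enorm_ge0 (X0 0))) // Xh // lexx oppr_le0 rt.
have pU : 0 <= hnorm (r + tau) U0.
  by rewrite (le_trans (enorm_ge0 (U0 0))) // Uh // lexx oppr_le0 addr_ge0.
have pz := enorm_ge0 z0.
rewrite pos_id ?addr_ge0 //; rewrite /bounded_upto sampling0.
split=> t /andP[ta tb]; have tE : t0 + (t - t0) = t by ring.
- have -> : t = t0 by apply/eqP; rewrite eq_le tb ta.
  by rewrite (dcl_z0 sol); lra.
- have := dcl_X0 sol (s := t - t0); rewrite /hist tE in_itv /= => ->.
    have : - r <= t - t0 <= 0 by apply/andP; split; lra.
    by move=> /Xh; lra.
  by apply/andP; split; lra.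
- have := dcl_U0 sol (s := t - t0); rewrite /hist tE in_itv /= => ->.
    have : - (r + tau) <= t - t0 <= 0 by apply/andP; split; lra.
    by move=> /Uh; lra.
  by apply/andP; split; lra.
Qed.

(** The observer is exact from the sampling time [S N.+1] on.  After a further
    [r + tau] all three windows (observer, vehicle history, input history) only
    contain times at which it decays; before, the bound on the transient over
    [M.+1] periods is used. *)
Lemma delayed_estimate : exists2 sigma' : R -> R -> R, class_KL sigma' &
  forall (t0 : R) X0 z0 U0 X z U, 0 <= t0 -> space_C0 r X0 -> space_Linf (r + tau) U0 ->
    delayed_closed_loop k r tau T t0 X0 z0 U0 X z U ->
    forall t, t0 <= t ->
      enorm (z t) + hnorm r (hist t X) + hnorm (r + tau) (hist t U) <=
      sigma' (enorm z0 + hnorm r X0 + hnorm (r + tau) U0) (t - t0).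
Proof.
have rt := r0; have tt := tau0; have Tt := T0.
pose N := Num.trunc (r / T).
have NT : r <= N.+1%:R * T.
  by rewrite -ler_pdivrMr // ltW //; have /andP[] := truncn_itv (divr_ge0 r0 (ltW T0)).
pose L := N.+1%:R * T + r + tau.
have L0 : 0 <= L by rewrite /L; lra.
pose M := Num.trunc (L / T).
have MT : L <= M.+1%:R * T.
  by rewrite -ler_pdivrMr // ltW //; have /andP[] := truncn_itv (divr_ge0 L0 (ltW T0)).
have [F Fg FB] := bounded_transient N.+1.
have [A Ag AB] := bounded_transient M.+1.
pose g1 s := 2%:R * pos s + input_gain s.
have g1g : gain g1.
  apply: gainD; last exact: input_gain_gain.
  by apply: gainZ => //; exact: gain_pos.
have a_gain : gain (fun s => 3%:R * A s) by exact: gainZ.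
exists (fun s t => g1 (sigma (F s) (pos (t - L))) + (3%:R * A s + s) * expR (L - t)).
  exact: KL_delay.
move=> t0 X0 z0 U0 X z U t0_ge0 hX0 hU0 sol t t0t.
have {}FB := FB _ _ _ _ _ _ _ t0_ge0 hX0 hU0 sol.
have {}AB := AB _ _ _ _ _ _ _ t0_ge0 hX0 hU0 sol.
have B0 : 0 <= enorm z0 + hnorm r X0 + hnorm (r + tau) U0.
  rewrite !addr_ge0 ?enorm_ge0 //.
  - have [M' XM] := space_C0_bounded hX0.
    by rewrite (le_trans (enorm_ge0 (X0 0))) // (hnorm_ub XM) // lexx oppr_le0 rt.
  - have [_ [M' UM]] := hU0; rewrite (le_trans (enorm_ge0 (U0 0))) //.
    apply: (@hnorm_ub _ _ _ _ M'); last by rewrite lexx oppr_le0 addr_ge0.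
    by move=> u hu; apply: UM; rewrite in_itv.
move: B0 FB AB; set B := enorm z0 + _ + _ => B0 [zF _ _] [zA XA UA].
have g1_ge0 s : 0 <= g1 s := gain_ge0 s g1g.
have A0 : 0 <= A B := gain_ge0 B Ag.
have [tL|Lt] := leP (t - t0) L.
  have e1 : 1 <= expR (L - (t - t0)) by rewrite -expR0 ler_expR; lra.
  have tS : t <= sampling_time t0 T M.+1 by rewrite /sampling_time; lra.
  apply: (@le_trans _ _ (3%:R * A B)).
    have h1 : enorm (z t) <= A B by rewrite zA // t0t.
    have h2 : hnorm r (hist t X) <= A B.
      by apply: hnorm_le => // s /andP[s1 s2]; apply: XA; apply/andP; split; lra.
    have h3 : hnorm (r + tau) (hist t U) <= A B.
      apply: hnorm_le => [|s /andP[s1 s2]]; first exact: addr_ge0.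
      by apply: UA; apply/andP; split; lra.
    by lra.
  apply: ler_wpDl => //; apply: (@le_trans _ _ (3%:R * A B + B)); first by rewrite lerDl.
  by rewrite ler_peMr // addr_ge0 // mulr_ge0.
apply: ler_wpDr; first by rewrite mulr_ge0 ?expR_ge0 // addr_ge0 // mulr_ge0.
rewrite pos_id; last by rewrite subr_ge0 ltW.
set e := sigma _ _; set SN := sampling_time t0 T N.+1.
have hN : t0 <= SN - r by rewrite /SN /sampling_time; lra.
have [_ _ _ sm _] := sigmaKL.
have ze s : SN + (t - t0 - L) <= s -> enorm (z s) <= e.
  move=> hs; have Ns : SN <= s by lra.
  apply: (le_trans (observer_tail_bound t0_ge0 sol hN Ns)); rewrite -/SN.
  have zN : enorm (z SN) <= F B by apply: zF; rewrite lexx andbT; exact: sampling_ge.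
  apply: (@le_trans _ _ (sigma (F B) (s - SN))).
    by apply: KL_le => //; rewrite ?enorm_ge0 ?subr_ge0.
  by apply: sm; [exact: gain_ge0|rewrite subr_ge0 ltW|rewrite lerBrDl].
have SNE : SN + (t - t0 - L) = t - r - tau by rewrite /SN /sampling_time /L; ring.
have e0 : 0 <= e.
  by apply: KL_ge0 => //; [rewrite subr_ge0 ltW|exact: gain_ge0].
rewrite /g1 (pos_id e0).
have h1 : enorm (z t) <= e by apply: ze; rewrite SNE; lra.
have h2 : hnorm r (hist t X) <= e.
  apply: hnorm_le => // s /andP[s1 s2]; rewrite /hist.
  have -> : X (t + s) = z (t + s - tau).
    by rewrite (observer_exact_after t0_ge0 sol hN) ?subrK // -/SN; lra.
  by apply: ze; rewrite SNE; lra.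
have h3 : hnorm (r + tau) (hist t U) <= input_gain e.
  apply: hnorm_le => [|s /andP[s1 s2]]; first exact: addr_ge0.
  rewrite /hist; apply: (input_bound t0_ge0 sol); last by apply: ze; rewrite SNE; lra.
  have : t0 < SN by rewrite /SN /sampling_time ltrDl mulr_gt0.
  by lra.
by lra.
Qed.

End Estimate.

(** * Existence of the delayed closed-loop solution *)

Section Predictor.
Variable R : realType.
Implicit Types (U V : R -> 'rV[R]_2).

Definition row2 (a b : R) : 'rV[R]_2 := \row_(j < 2) nth 0 [:: a; b] j.

Lemma row2E (a b : R) : (row2 a b 0 0 = a) * (row2 a b 0 1 = b).
Proof. by rewrite /row2 !mxE. Qed.

Lemma within_row n (A : set R) (X : R -> 'rV[R]_n) :
  (forall j, {within A, continuous (fun s => X s 0 j)}) -> {within A, continuous X}.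
Proof.
move=> cX; apply/subspace_continuousP => x Ax.
apply: (cvg_row (F := within A (nbhs x))) => j.
by have /subspace_continuousP/(_ x Ax) := cX j.
Qed.

(** The prediction at [b] ignores the input at [b], which is what makes the
    reset well defined. *)
Lemma predictor_eq a b q U V :
  (forall b' i, lbounded a b' (fun s => U s 0 i)) ->
  (forall b' i, lbounded a b' (fun s => V s 0 i)) ->
  (forall s, a <= s < b -> U s = V s) -> predictor a b q U = predictor a b q V.
Proof.
move=> bU bV UV; apply/rowP => j; rewrite !predictorE; congr (_ + _).
apply: lint_eq_oo; try exact: heading_field_lbounded.
move=> s /andP[h1 h2]; rewrite UV ?(ltW h1) //; congr (vehicle_field (vec3 _ _ (_ + _)) _ _ _).
by apply: lint_eq => p /andP[p1 p2]; rewrite UV // p1 (le_lt_trans p2).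
Qed.

Lemma predictor_continuous a q U :
  (forall b i, lbounded a b (fun s => U s 0 i)) ->
  {within `[a, +oo[, continuous (fun t => predictor a t q U)}.
Proof.
move=> bU; apply: within_row => j.
apply: (@subspace_eq_continuous _ _ _ (fun t => q 0 j + lint a (Num.max a t) (fun s =>
    vehicle_field (vec3 0 0 (q 0 2 + lint a s (fun p => U p 0 1))) (U s) 0 j))).
  move=> t; rewrite inE /= in_itv /= andbT => /max_idPr at_.
  by rewrite /from_subspace predictorE at_.
apply: continuous_subspaceT => t; apply: cvgD; first exact: cvg_cst.
by apply: lint_clamp_continuous => b; exact: heading_field_lbounded.
Qed.

Lemma predictor_point a q U : predictor a a q U = q.
Proof. by apply/rowP => j; rewrite predictorE lint_point addr0. Qed.

End Predictor.

Section Existence.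
Variables (R : realType) (k : R -> 'rV[R]_3 -> 'rV[R]_2) (r tau T : R).
Hypotheses (r0 : 0 <= r) (tau0 : 0 <= tau) (T0 : 0 < T).
Hypothesis kC1 : C1_halfspace k.
Variables (t0 : R) (X0 : R -> 'rV[R]_3) (z0 : 'rV[R]_3) (U0 : R -> 'rV[R]_2).
Hypotheses (t0_ge0 : 0 <= t0) (X0C : space_C0 r X0) (U0L : space_Linf (r + tau) U0).
Variable Y : R -> 'rV[R]_3 -> R -> 'rV[R]_3.
Hypothesis Ysol : forall a x, 0 <= a -> chained_closed_loop k a x (Y a x).
Notation S := (sampling_time t0 T).
Implicit Types (Z : R -> 'rV[R]_3) (w : 'rV[R]_3).

Definition feedback Z t : 'rV[R]_2 :=
  let u := k (t + tau) (zeta (Z t)) in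
  row2 (u 0 0 + (Z t 0 0 * sin (Z t 0 2) - Z t 0 1 * cos (Z t 0 2)) * u 0 1) (u 0 1).

Definition input Z t := if t <= t0 then U0 (t - t0) else feedback Z t.

(** Beyond the initial time the vehicle is an open-loop prediction driven by the
    delayed input, since its equations can be integrated explicitly. *)
Definition state Z t :=
  if t <= t0 then X0 (t - t0)
  else predictor t0 t (X0 0) (fun p => input Z (p - tau)).

Definition reset Z i :=
  let b := S i in predictor (b - r - tau) b (state Z (b - r)) (input Z).

(** The observer trajectory issued from [w] at the [i]-th sampling time. *)
Definition flow i w t := zeta (Y (S i + tau) (zeta w) (t + tau)).

(** The observer up to the next reset only depends on its past, so the solution
    is built one sampling period at a time. *)
Fixpoint observer i : R -> 'rV[R]_3 :=
  if i is j.+1 then fun t =>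
    if t < S j.+1 then observer j t else flow j.+1 (reset (observer j) j.+1) t
  else flow 0 z0.

Definition observer_init i := if i is j.+1 then reset (observer j) j.+1 else z0.

Definition observer_sol t := observer (Num.trunc ((t - t0) / T)) t.

Lemma observer_flow i t : S i <= t -> observer i t = flow i (observer_init i) t.
Proof. by case: i => // i h /=; rewrite ltNge h. Qed.

Lemma observer_le i j t : (i <= j)%N -> t < S i.+1 -> observer j t = observer i t.
Proof.
move=> ij ti; elim: j ij => [|j IH]; first by rewrite leqn0 => /eqP ->.
rewrite leq_eqVlt => /orP[/eqP <- //|ij].
rewrite -IH //= (lt_le_trans ti) //; exact: sampling_le.
Qed.

Lemma observer_solE i t : t0 <= t -> t < S i.+1 -> observer_sol t = observer i t.
Proof.
move=> t0t ti; rewrite /observer_sol; set n := Num.trunc _.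
have tt : 0 <= (t - t0) / T by rewrite divr_ge0 ?subr_ge0 // ltW.
have /andP[n1 n2] := truncn_itv tt.
have Sn : t < S n.+1.
  by rewrite /sampling_time -ltrBlDl -ltr_pdivrMr.
have [ni|i_n] := leqP n i; first by rewrite (@observer_le n i).
by rewrite (@observer_le i n) // ltnW.
Qed.

Lemma flow_start i w : flow i w (S i) = w.
Proof.
have h : 0 <= S i + tau.
  by have := sampling_ge t0 T0 i; have := t0_ge0; have := tau0; lra.
by have [Ya _ _] := Ysol (zeta w) h; rewrite /flow Ya zetaK.
Qed.

Lemma flow_continuous i w : {within `[S i, +oo[, continuous (flow i w)}.
Proof.
have h : 0 <= S i + tau.
  by have := sampling_ge t0 T0 i; have := t0_ge0; have := tau0; lra.
have [_ Yc _] := Ysol (zeta w) h.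
have Yc' : {within `[S i, +oo[, continuous (fun s => Y (S i + tau) (zeta w) (s + tau))}.
  have := @within_shift _ _ (`[S i + tau, +oo[)%classic (`[S i, +oo[)%classic
    (Y (S i + tau) (zeta w)) (- tau).
  rewrite opprK; apply => // s /=; by rewrite !in_itv /= !andbT lerD2r.
move=> x; apply: (@continuous_comp _ _ _ (from_subspace _ _) (@zeta R)).
  exact: Yc'.
exact: zeta_continuous.
Qed.

Lemma feedback_continuous Z a b j : t0 <= a -> {within `[a, b], continuous Z} ->
  {within `[a, b], continuous (fun s => feedback Z s 0 j)}.
Proof.
move=> ha cZ.
have czZ : {within `[a, b], continuous (fun s => zeta (Z s))}.
  move=> x; apply: (@continuous_comp _ _ _ (from_subspace _ Z) (@zeta R)).
    exact: cZ.
  exact: zeta_continuous.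
have ck i : {within `[a, b], continuous (fun s => k (s + tau) (zeta (Z s)) 0 i)}.
  apply: within_coord.
  apply: (@subspace_eq_continuous _ _ _ (fun s => k (Num.max 0 (s + tau)) (zeta (Z s)))).
    move=> s; rewrite inE /= in_itv /= => /andP[as_ _].
    by rewrite (max_idPr _) //; have := t0_ge0; have := tau0; lra.
  have Kc := C1_halfspace_continuous kC1.
  apply/subspace_continuousP => x hx.
  have /subspace_continuousP/(_ x hx) c1 := czZ.
  have c2 : (s + tau) @[s --> within `[a, b]%classic (nbhs x)] --> x + tau.
    by apply: cvg_within_filter; apply: cvgD; [exact: cvg_id|exact: cvg_cst].
  have c3 : (s + tau, zeta (Z s)) @[s --> within `[a, b]%classic (nbhs x)] --> (x + tau, zeta (Z x)).
    exact: (@cvg_pair _ _ _ _ (nbhs (x + tau)) (nbhs (zeta (Z x)))).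
  exact: (cvg_comp _ _ c3 (Kc (x + tau, zeta (Z x)))).
elim/ord2_ind: j.
  apply: (@subspace_eq_continuous _ _ _ (fun s => k (s + tau) (zeta (Z s)) 0 0 +
      zeta (Z s) 0 1 * k (s + tau) (zeta (Z s)) 0 1)).
    by move=> s _; rewrite /from_subspace /feedback row2E /zeta vec3E.
  move=> x; apply: cvgD; first exact: ck.
  by apply: cvgM; [exact: (within_coord czZ)|exact: ck].
apply: subspace_eq_continuous (ck 1).
by move=> s _; rewrite /from_subspace /feedback row2E.
Qed.

Lemma flow_feedback_lbounded i w b j :
  lbounded (S i) b (fun s => feedback (flow i w) s 0 j).
Proof.
apply: lbounded_continuous; apply: feedback_continuous; first exact: sampling_ge.
apply: continuous_subspaceW (@flow_continuous i w) => s /=.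
by rewrite !in_itv /= => /andP[->].
Qed.

Lemma initial_input_lbounded j : lbounded (t0 - r - tau) t0 (fun s => U0 (s - t0) 0 j).
Proof.
have [mU [M UM]] := U0L.
have h : lbounded (- (r + tau)) 0 (fun s => U0 s 0 j).
  split; first exact: mU.
  by exists M => s hs; apply: le_trans (enorm_coord _ _) (UM s _); rewrite in_itv.
have := lbounded_shift t0 h; rewrite add0r.
by rewrite (_ : - (r + tau) + t0 = t0 - r - tau) //; ring.
Qed.

(** The input is an initial datum followed by finitely many continuous pieces on
    any bounded interval. *)
Lemma observer_input_lbounded i a b j : t0 - r - tau <= a ->
  lbounded a b (fun s => input (observer i) s 0 j).
Proof.
move=> ha; suff H b' : S i <= b' -> lbounded (t0 - r - tau) b' (fun s => input (observer i) s 0 j).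
  apply: (@lbounded_sub _ (t0 - r - tau) (Num.max (S i) b)) => //.
    by rewrite le_max lexx orbT.
  by apply: H; rewrite le_max lexx.
have rt := r0; have tt := tau0; elim: i b' {ha a b} => [|i IH] b ib.
  rewrite sampling0 in ib.
  apply: (lbounded_cat _ ib (initial_input_lbounded j)).
  - by lra.
  - by have := @flow_feedback_lbounded 0 z0 b j; rewrite sampling0; exact.
  - by move=> s /andP[_ st]; rewrite /input ltW.
  - by move=> s /andP[st _]; rewrite /input leNgt st.
have Si := sampling_lt t0 T0 i; have t0S := sampling_ge t0 T0 i.
apply: (lbounded_cat _ ib (IH (S i.+1) (ltW Si))).
- by move: Si t0S rt tt; lra.
- exact: (@flow_feedback_lbounded i.+1 (observer_init i.+1) b j).
- by move=> s /andP[_ sS]; rewrite /input /feedback /= sS.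
- move=> s /andP[sS _]; rewrite /input leNgt (lt_trans _ sS) ?(le_lt_trans t0S) //=.
  by rewrite /feedback ltNge (ltW sS).
Qed.

Lemma input_eq Z1 Z2 c : (forall s, t0 < s < c -> Z1 s = Z2 s) ->
  forall s, s < c -> input Z1 s = input Z2 s.
Proof.
move=> ZZ s sc; rewrite /input; case: leP => // t0s.
by rewrite /feedback ZZ // t0s.
Qed.

Lemma sol_input_eq i s : s < S i.+1 -> input observer_sol s = input (observer i) s.
Proof.
by apply: input_eq => {}s /andP[h1 h2]; rewrite (@observer_solE i) // ltW.
Qed.

Lemma sol_input_lbounded a b j : t0 - r - tau <= a ->
  lbounded a b (fun s => input observer_sol s 0 j).
Proof.
move=> ha; have h : t0 <= Num.max t0 b by rewrite le_max lexx.
have [i /andP[_ bi]] := sampling_interval T0 h.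
apply: (lbounded_eq _ (@observer_input_lbounded i a b j ha)) => s /andP[_ sb].
by rewrite (@sol_input_eq i) // (le_lt_trans sb) // (le_lt_trans _ bi) // le_max lexx orbT.
Qed.

Lemma shifted_input_lbounded Z :
  (forall b j, lbounded (t0 - r - tau) b (fun s => input Z s 0 j)) ->
  forall b j, lbounded t0 b (fun s => input Z (s - tau) 0 j).
Proof.
move=> bZ b j; have := lbounded_shift tau (bZ (b - tau) j); rewrite !subrK.
by apply: lbounded_sub => //; have := r0; lra.
Qed.

Lemma sol_state_eq i t : t <= S i.+1 -> state observer_sol t = state (observer i) t.
Proof.
move=> ti; rewrite /state; case: leP => // t0t; apply: predictor_eq.
- by apply: shifted_input_lbounded => b j; exact: sol_input_lbounded.
- by apply: shifted_input_lbounded => b j; exact: observer_input_lbounded.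
- move=> s /andP[_ st]; apply: sol_input_eq.
  by have := tau0; lra.
Qed.

Lemma state_continuous : {within `[t0 - r, +oo[, continuous (state observer_sol)}.
Proof.
have rt := r0.
have -> : `[t0 - r, +oo[%classic = `[t0 - r, t0] `|` `[t0, +oo[ :> set R.
  apply/seteqP; split => s /=; rewrite !in_itv /= !andbT.
    by move=> ?; case: (leP s t0) => ?; [left|right; exact: ltW]; apply/andP.
  by case=> [/andP[]//|]; move: rt; lra.
apply: withinU_continuous.
- exact: interval_closed.
- exact: interval_closed.
- apply: (@subspace_eq_continuous _ _ _ (fun s => X0 (s - t0))).
    by move=> s; rewrite inE /= in_itv /= => /andP[_ h]; rewrite /from_subspace /state h.
  apply: (within_shift (X := X0)) X0C => s /=; rewrite !in_itv /= => /andP[h1 h2].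
  by apply/andP; split; lra.
- apply: (@subspace_eq_continuous _ _ _
      (fun t => predictor t0 t (X0 0) (fun p => input observer_sol (p - tau)))).
    move=> s; rewrite inE /= in_itv /= andbT le_eqVlt => /orP[/eqP <-|h].
      by rewrite /from_subspace predictor_point /state lexx subrr.
    by rewrite /from_subspace /state leNgt h.
  apply: predictor_continuous; apply: shifted_input_lbounded => b j.
  exact: sol_input_lbounded.
Qed.

Lemma sol_flow i t : S i <= t -> t < S i.+1 ->
  observer_sol t = flow i (observer_init i) t.
Proof.
move=> h1 h2; rewrite (@observer_solE i) ?observer_flow //.
exact: le_trans (sampling_ge t0 T0 i) h1.
Qed.

(** The observer is a flow on each sampling interval by construction; the reset
    rule holds because the vehicle and the input before a sampling time are those
    of the approximation from which the reset was computed. *)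
Lemma delayed_solution :
  delayed_closed_loop k r tau T t0 X0 z0 U0 (state observer_sol) observer_sol
    (input observer_sol).
Proof.
have rt := r0; have tt := tau0; split.
- move=> s; rewrite in_itv /= => /andP[_ s0]; rewrite /hist /state.
  rewrite (_ : t0 + s <= t0) ?gerDl //; congr X0; ring.
- rewrite (@sol_flow 0) ?sampling0 //=; last first.
    by have := sampling_lt t0 T0 0; rewrite sampling0.
  by rewrite -{1}(sampling0 t0 T) flow_start.
- move=> s; rewrite in_itv /= => /andP[_ s0]; rewrite /hist /input.
  rewrite (_ : t0 + s <= t0) ?gerDl //; congr U0; ring.
- exact: state_continuous.
- move=> t t0t.
  have h j : lbounded (- (t - t0 + r + tau)) 0 (fun s => hist t (input observer_sol) s 0 j).
    have := lbounded_shift (- t) (@sol_input_lbounded (t0 - r - tau) t j (lexx _)).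
    rewrite subrr (_ : t0 - r - tau - t = - (t - t0 + r + tau)); last by ring.
    by apply: lbounded_eq => s _; rewrite /hist opprK addrC.
  split; first by move=> j; have [] := h j.
  have [M HM] := choice (fun j => (h j).2); exists (\sum_j M j) => s.
  rewrite in_itv /= => hs; rewrite (le_trans (enorm_le_sum _)) // ler_sum // => j _.
  exact: HM.
- move=> t j t0t; set X := state _; have X00 : X t0 = X0 0 by rewrite /X /state lexx subrr.
  have XE s : t0 <= s -> X s = predictor t0 s (X0 0) (fun p => input observer_sol (p - tau)).
    rewrite le_eqVlt => /orP[/eqP <-|h]; first by rewrite predictor_point.
    by rewrite /X /state leNgt h.
  rewrite XE // X00 predictorE; congr (_ + _); apply: lint_eq => s /andP[h1 _].
  by rewrite /vehicle_field !vec3E XE // predictorE; congr (vec3 (_ * cos (_ + _)) (_ * sin (_ + _)) _ _ _);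
    apply: lint_eq => p _; rewrite /vehicle_field vec3E.
- move=> i; apply: (@subspace_eq_continuous _ _ _ (flow i (observer_init i))).
    by move=> s; rewrite inE /= in_itv /= => /andP[h1 h2]; rewrite /from_subspace (@sol_flow i).
  apply: continuous_subspaceW (@flow_continuous i (observer_init i)) => s /=.
  by rewrite !in_itv /= => /andP[->].
- move=> i t h1 h2; set w := zeta (observer_init i).
  have t0t : t0 < t := le_lt_trans (sampling_ge t0 T0 i) h1.
  pose y s := Y (S i + tau) w (s + tau).
  have zE : observer_sol t = zeta (y t) by rewrite (@sol_flow i) // ltW.
  have a0 : 0 <= S i + tau.
    by have := sampling_ge t0 T0 i; have := t0_ge0; lra.
  have [_ _ Ys] := Ysol w a0.
  have yd : solves_at y t (chained_field (y t) (k (t + tau) (y t))).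
    have := solves_at_shift (- tau) (Ys (t + tau) _); rewrite addrK opprK; apply.
    by rewrite ltrD2r.
  rewrite zE; apply: (solves_at_eq (x := fun s => zeta (y s))).
    near=> s; rewrite (@sol_flow i) //.
      by apply: ltW; near: s; exact: lt_nbhsr.
    by near: s; exact: lt_nbhsl.
  apply: zeta_chained yd.
    by rewrite /input leNgt t0t /feedback /= row2E zE zetaK.
  rewrite /input leNgt t0t /feedback /= row2E zE zetaK; congr (_ + _ * _).
  have ztE (x : 'rV[R]_3) : zeta x 0 1 = x 0 0 * sin (x 0 2) - x 0 1 * cos (x 0 2).
    by rewrite /zeta vec3E.
  by rewrite -ztE zetaK.
- move=> i /=; set b := S i.+1.
  rewrite (@sol_flow i.+1) ?flow_start ?sampling_lt //= /reset -/b.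
  rewrite -(@sol_state_eq i) -/b; last by lra.
  have t0b := sampling_ge t0 T0 i; have := sampling_lt t0 T0 i; rewrite -/b => Sb.
  apply: predictor_eq.
  + by move=> b' j; apply: observer_input_lbounded; lra.
  + by move=> b' j; apply: sol_input_lbounded; lra.
  + by move=> s /andP[_ sb]; rewrite (@sol_input_eq i).
- move=> t t0t; rewrite {1}/input leNgt t0t /= {1}/feedback row2E.
  by rewrite /input leNgt t0t /= /feedback row2E.
- by move=> t t0t; rewrite /input leNgt t0t /= /feedback row2E.
Unshelve. all: by end_near. Qed.

End Existence.

Theorem corollary4p1 (R : realType) (k : R -> 'rV[R]_3 -> 'rV[R]_2) :
  C1_halfspace k ->
  (forall t, 0 <= t -> k t 0 = 0) ->
  time_periodic k ->
  stabilizes_chained k ->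
  forall r tau T : R, 0 <= r -> 0 <= tau -> 0 < T ->
  delayed_stabilizes k r tau T.
Proof.
move=> kC1 k0 kP [sigma sigmaKL k_stab] r tau T r0 tau0 T0.
have [beta beta_gain k_beta] := feedback_gain kC1 k0 kP.
have [sigma' sigma'KL est] :=
  delayed_estimate r0 tau0 T0 kC1 sigmaKL k_stab beta_gain k_beta.
exists sigma' => // t0 X0 z0 U0 t0_ge0 X0C U0L; split; last first.
  by move=> X z U sol t t0t; exact: est sol t t0t.
have exY (p : R * 'rV[R]_3) :
    exists y, 0 <= p.1 -> chained_closed_loop k p.1 p.2 y.
  have [p0|p0] := boolP (0 <= p.1); last by exists (fun=> 0).
  by have [[y ysol] _] := k_stab p.1 p.2 p0; exists y.
have [Y Ysol] := choice exY.
have Ysol' (a : R) (x : 'rV[R]_3) : 0 <= a -> chained_closed_loop k a x (Y (a, x)).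
  exact: (Ysol (a, x)).
by do 3 eexists; exact: (delayed_solution r0 tau0 T0 kC1 z0 t0_ge0 X0C U0L Ysol').
Qed.
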